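(* Let $K_1,\ldots,K_d$ be compact nc convex sets, and suppose $f:K_1\times\cdots\times K_d\to\mathcal{M}^{\mathrm{sa}}$ is a continuous separately nc convex nc function. Suppose $$\mu:C(K_1\times\cdots\times K_d)\cong C(K_1)\ast\cdots\ast C(K_d)\to M_k$$ is a free product ucp map of any ucp maps $\mu_i:C(K_i)\to M_k$, $i=1,\ldots,d$. Then $f$ satisfies the Jensen inequality $$f(\mathrm{bar}(\mu))\le \mu(f).$$
   Context: Cardinals and matrices. Fix an infinite cardinal $\kappa$, sufficiently large (at least the density characters of the spaces and C*-algebras involved); all Hilbert spaces considered have dimension at most $\kappa$. For a cardinal $n\le\kappa$, $H_n$ is a Hilbert space of dimension $n$, $M_n=B(H_n)$, $M_{p,n}=B(H_n,H_p)$; $B(H)$ is identified with $M_n$ when $\dim H=n$. For a dual operator space $E=(E_* )^*$, $M_n(E)$ is identified with the space $CB(E_*,M_n)$ of completely bounded maps, with its weak-$*$ topology (point-weak-$*$ on bounded sets), and $(\alpha x\beta)(e)=\alpha x(e)\beta$ for matrices $\alpha,\beta$. Put $\mathcal{M}(E)=\coprod_{n\le\kappa}M_n(E)$, $\mathcal{M}=\mathcal{M}(\mathbb{C})$, and let $\mathcal{M}^{\mathrm{sa}}$ be its selfadjoint part. nc convex sets. $K\subseteq\mathcal{M}(E)$, with levels $K(n)=K\cap M_n(E)$, is nc convex if it is closed under direct sums (of norm-bounded families) and compressions by isometries; equivalently $\sum_i\alpha_i^*x_i\alpha_i\in K(n)$ whenever $(x_i)$ is a norm-bounded family, $x_i\in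 K(n_i)$, $\alpha_i\in M_{n_i,n}$, $\sum_i\alpha_i^*\alpha_i=I_n$ (weak-$*$ convergent). It is a compact nc convex set if moreover each $K(n)$ is weak-$*$ compact. Compact nc convex sets are taken nonempty. Products are levelwise: $(K_1\times\cdots\times K_d)(n)=K_1(n)\times\cdots\times K_d(n)$; this is again a compact nc convex set. nc functions. An nc function between nc convex sets is a map that is graded (sends level $n$ to level $n$), preserves (arbitrary) direct sums and preserves unitary equivalence. It is nc affine if also $a(\alpha^*x\alpha)=\alpha^*a(x)\alpha$ for all isometries $\alpha$. $A(K)$ is the operator system of levelwise weak-$*$ continuous nc affine functions $K\to\mathcal{M}$. $C(K)$ is the C*-algebra generated by $A(K)$ in the C*-algebra of bounded nc functions $K\to\mathcal{M}$ with pointwise operations; it equals the algebra of bounded nc functions that are continuous on each level for the point-ultrastrong-$*$ topology. A continuous nc function $f:K\to\mathcal M^{\mathrm{sa}}$ means one continuous on each level, either weak-$*$ to weak-$*$ or point-ultrastrong-$*$ to ultrastrong-$*$. With $\ast$ the unital free product of C*-algebras (amalgamated over $\mathbb{C}$), $C(K_1\times\cdots\times K_d)\cong C(K_1)\ast\cdots\ast C(K_d)$, where $g\in C(K_i)$ corresponds to $(x_1,\ldots,x_d)\mapsto g(x_i)$. Barycenters. For a ucp (unital completely positive) map $\mu:C(K)\to M_k$ ($k\le\kappa$), $\mathrm{bar}(\mu)$ is the unique point of $K(k)$ with $a(\mathrm{bar}(\mu))=\mu(a)$ for all $a\in A(K)$. Every such $\mu$ has the form $\mu(g)=\alpha^*g(x)\alpha$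 with $x\in K(p)$ and $\alpha\in M_{p,k}$ an isometry; for an nc function $f$ on $K$ set $\mu(f)=\alpha^*f(x)\alpha$ (independent of the choice, and the usual value if $f\in C(K)$). Separate nc convexity. For $x\in K(n)$, $y\in K(p)$ and an isometry $\alpha\in M_{p,n}$, write $x\prec_\alpha y$ if $\alpha^*y\alpha=x$ (coordinatewise for products); this dilation is trivial if $\alpha\alpha^*y=y\alpha\alpha^*$. An nc function $f:\prod_iK_i\to\mathcal{M}^{\mathrm{sa}}$ is separately nc convex if $f(x)\le\alpha^*f(y)\alpha$ whenever $x\prec_\alpha y$ in $\prod_iK_i$ and at most one of the coordinate dilations $x_i\prec_\alpha y_i$ is not trivial. Free product ucp maps. Let $A=\ast_{i\in I}A_i$ be a unital free product of unital C*-algebras, and $S_I$ the set of finite words in $I$ (including the empty word $\emptyset$) with no two consecutive letters equal. Let $\mu:A\to B(H)$ be ucp with minimal Stinespring dilation $\pi:A\to B(L)$, $L\supseteq H$. Set $L_\emptyset=H$ and inductively $L_{iw}=\overline{\pi(A_i)L_w}\ominus L_w$ (closed linear span) for $w\in S_I$ not beginning with $i$. Then $\mu$ is a free product ucp map (of the maps $\mu_i=\mu|_{A_i}$) if the spaces $L_w$, $w\in S_I$, are pairwise orthogonal. *)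

(* Defs.v *)
From HB Require Import structures.
From mathcomp Require Import all_boot all_order all_algebra.
From mathcomp Require Import complex.
From mathcomp Require Import all_classical all_reals all_analysis.

Set Implicit Arguments.
Unset Strict Implicit.
Unset Printing Implicit Defensive.

Import Order.TTheory GRing.Theory Num.Theory Num.Def.
Import numFieldNormedType.Exports.

Local Open Scope classical_set_scope.
Local Open Scope ring_scope.
Local Open Scope complex_scope.

(* [hdot] is linear in its first argument. *)
Record hilbert (R : realType) := Hilbert {
  hsort :> completeNormedModType R[i];
  hdot : {dot hsort for (@conjC R[i])};
  hdotE : forall x : hsort, `|x| ^+ 2 = hdot x x }.

Section ClosedSpan.
Variables (R : realType) (H : hilbert R).

Definition closed_subspace (S : set H) :=
  [/\ closed S, S 0 & forall (a : R[i]) x y, S x -> S y -> S (a *: x + y)].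

Definition cspan (A : set H) : set H := smallest closed_subspace A.

Definition orthogonal_sets (A B : set H) :=
  forall x y, A x -> B y -> hdot H x y = 0.

Definition ocompl (A : set H) : set H :=
  [set x | forall y, A y -> hdot H x y = 0].

End ClosedSpan.

Section BoundedOperators.
Variables (R : realType) (H K : hilbert R).

Definition bounded_op_pred : {pred H -> K} := fun f =>
  `[< linear f /\ exists c : R[i], forall x, `|f x| <= c * `|x| >].

Record bop := Bop { bop_fun :> H -> K; bop_funP : bop_fun \in bounded_op_pred }.

HB.instance Definition _ := [isSub for bop_fun].
HB.instance Definition _ := [Choice of bop by <:].

Lemma bounded_op_submod : submod_closed bounded_op_pred.
Proof.
split=> [|a f g /asboolP[fl [c fc]] /asboolP[gl [e ge]]]; apply/asboolP.
  split=> [b x y|]; first by rewrite scaler0 addr0.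
  by exists 0 => x; rewrite normr0 mul0r.
split=> [b x y|].
  change (a *: f (b *: x + y) + g (b *: x + y) =
          b *: (a *: f x + g x) + (a *: f y + g y)).
  rewrite fl gl !scalerDr !scalerA (mulrC a b) -!addrA; congr (_ + _).
  by rewrite addrCA.
exists (`|a| * c + e) => x.
change (`|a *: f x + g x| <= (`|a| * c + e) * `|x|).
rewrite mulrDl (le_trans (ler_normD _ _))// lerD// normrZ -mulrA.
by rewrite ler_wpM2l.
Qed.

HB.instance Definition _ :=
  GRing.isSubmodClosed.Build _ _ bounded_op_pred bounded_op_submod.
HB.instance Definition _ := [SubChoice_isSubLmodule of bop by <:].

End BoundedOperators.

Section Operators.
Variable R : realType.
Implicit Types H K L : hilbert R.

Lemma bounded_op_comp H K L (S : bop K L) (T : bop H K) :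
  (S \o T : H -> L) \in @bounded_op_pred R H L.
Proof.
have /asboolP[Sl [c Sc]] := bop_funP S; have /asboolP[Tl [e Te]] := bop_funP T.
apply/asboolP; split=> [a x y|]; first by rewrite /= Tl Sl.
exists (`|c| * e) => x /=; rewrite (le_trans (Sc _))//.
rewrite (le_trans (real_ler_norm _))//.
  by rewrite (ger0_real (le_trans (normr_ge0 _) (Sc (T x)))).
by rewrite normrM normr_id -mulrA ler_wpM2l.
Qed.

Definition bcomp H K L (S : bop K L) (T : bop H K) : bop H L :=
  Bop (bounded_op_comp S T).

Lemma bounded_op_id H : (id : H -> H) \in @bounded_op_pred R H H.
Proof.
by apply/asboolP; split=> //; exists 1 => x; rewrite mul1r.
Qed.

Definition bid H : bop H H := Bop (bounded_op_id H).

Definition adj H K (T : bop H K) : bop K H :=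
  xget 0 [set S : bop K H | forall x y, hdot K (T x) y = hdot H x (S y)].

Definition opbound H K (T : bop H K) (c : R[i]) :=
  forall x, `|T x| <= c * `|x|.

Definition isom H K (T : bop H K) := forall x, `|T x| = `|x|.

Definition unitary_op H K (T : bop H K) :=
  isom T /\ forall y, exists x, T x = y.

Definition selfadj H (T : bop H H) := adj T = T.

(* [0 <= z] in [R[i]] includes that z is real. *)
Definition psd H (T : bop H H) := forall x, 0 <= hdot H (T x) x.

Definition ople H (S T : bop H H) := psd (T - S).

Definition mx_psd H n (T : 'M[bop H H]_n) := forall xi : 'I_n -> H,
  0 <= \sum_i \sum_j hdot H (T i j (xi j)) (xi i).

(* The operator [T i j] acting on H^n has norm at most c. *)
Definition mx_opbound H K n (T : 'M[bop H K]_n) (c : R[i]) :=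
  0 <= c /\ forall xi : 'I_n -> H,
    \sum_i `|\sum_j T i j (xi j)| ^+ 2 <= c ^+ 2 * \sum_j `|xi j| ^+ 2.

(* H is the Hilbert space direct sum of the [Hs j] along the isometries
   [al j]. *)
Definition hilbert_sum (J : Type) (Hs : J -> hilbert R) H
    (al : forall j, bop (Hs j) H) :=
  [/\ forall j, isom (al j),
      forall j j', j <> j' -> orthogonal_sets (range (al j)) (range (al j')) &
      cspan (\bigcup_j range (al j)) = setT].

Definition hdim_le H (Kap : Type) := exists (J : set Kap) (b : Kap -> H),
  [/\ forall i, J i -> hdot H (b i) (b i) = 1,
      forall i j, J i -> J j -> i <> j -> hdot H (b i) (b j) = 0 &
      cspan (b @` J) = setT].

End Operators.

Section OperatorTopologies.
Variables (R : realType) (H : hilbert R).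

Record sqsum := Sqsum { sqsum_seq :> nat -> H;
  sqsumP : exists M : R[i],
    forall n, \sum_(k < n) `|sqsum_seq k| ^+ 2 <= M }.

(* The weak-* continuous functionals on B(H) are those of the form
   [T |-> \sum_k <T xi_k, eta_k>]. *)
Definition normal_functional (p : sqsum * sqsum) (T : bop H H) : R[i]^o :=
  limn (fun n => \sum_(k < n) hdot H (T (p.1 k)) (p.2 k) : R[i]^o).

Definition ustrong_seminorm (xi : sqsum) (T : bop H H) : R[i]^o :=
  sqrtC (limn (fun n =>
    \sum_(k < n) (`|T (xi k)| ^+ 2 + `|adj T (xi k)| ^+ 2) : R[i]^o)).

Definition weakstar : topologicalType := initial_topology
  (fun T : bop H H =>
     (fun p => normal_functional p T) : {ptws sqsum * sqsum -> R[i]^o}).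

(* The locally convex topology of a family of seminorms q is the initial
   topology of the maps [T |-> q (T - T0)]. *)
Definition ustrongstar : topologicalType := initial_topology
  (fun T : bop H H =>
     (fun p => ustrong_seminorm p.1 (T - p.2))
       : {ptws sqsum * bop H H -> R[i]^o}).

End OperatorTopologies.

(* A norm-closed subspace of some B(H). *)
Record opspace (R : realType) := Opspace {
  ambient : hilbert R;
  opsub : set (bop ambient ambient);
  opsub0 : opsub 0;
  opsubP : forall (a : R[i]) u v, opsub u -> opsub v -> opsub (a *: u + v);
  opsub_closed : forall u,
    (forall e : R[i], 0 < e -> exists2 v, opsub v & opbound (u - v) e) ->
    opsub u }.

Definition opcar (R : realType) (V : opspace R) : Type := set_type (@opsub R V).

Definition opval (R : realType) (V : opspace R) (v : opcar V) :
  bop (ambient V) (ambient V) := set_val v.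

(* A choice of a Hilbert space H_n for each cardinal n at most the cardinality
   of [Kap]. *)
Record levels (R : realType) (Kap : Type) := Levels {
  cardinal :> Type;
  Hn : cardinal -> hilbert R;
  Hn_dim : forall n, hdim_le (Hn n) Kap;
  Hn_exists : forall L : hilbert R, hdim_le L Kap ->
    exists n (u : bop L (Hn n)), unitary_op u;
  Hn_unique : forall m n (u : bop (Hn m) (Hn n)), unitary_op u -> m = n }.
Coercion Hn : cardinal >-> hilbert.

(* A graded set of X-indexed families of operators. For K in M(E), X is
   the predual of E, and a point of K is a map from X to B(H); for
   a product K_1 x ... x K_d, X is the disjoint union of the preduals. *)
Definition gset (R : realType) (Kap : Type) (lv : levels R Kap) (X : Type) :=
  forall H : lv, set (X -> bop H H).

Section Points.
Variables (R : realType) (Kap : Type) (lv : levels R Kap) (X : Type).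
Implicit Types H L : lv.

Definition compress H L (al : bop H L) (x : X -> bop L L) : X -> bop H H :=
  fun e => bcomp (adj al) (bcomp (x e) al).

Definition is_dsum (J : Type) (Hs : J -> lv) H
    (al : forall j, bop (Hs j) H) (xs : forall j, X -> bop (Hs j) (Hs j))
    (x : X -> bop H H) :=
  hilbert_sum al /\
  forall j e, bcomp (x e) (al j) = bcomp (al j) (xs j e).

End Points.

Section DualOperatorSpace.
Variables (R : realType) (Kap : Type) (lv : levels R Kap) (V : opspace R).
Implicit Types H L : lv.

Definition cbbound H (x : opcar V -> bop H H) (c : R[i]) :=
  0 <= c /\ forall n (v : 'M[opcar V]_n) b,
    mx_opbound (map_mx (@opval R V) v) b -> mx_opbound (map_mx x v) (c * b).

(* M_n(E) = CB(E_*, M_n), where E_* = V. *)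
Definition ncE : gset lv (opcar V) := fun H => [set x |
  (forall (a : R[i]) (u v w : opcar V),
     opval w = a *: opval u + opval v -> x w = a *: x u + x v) /\
  exists c, cbbound x c].
Arguments ncE : clear implicits.

Definition nc_convex (K : gset lv (opcar V)) :=
  [/\ forall H, K H `<=` ncE H,
      forall (J : Type) (Hs : J -> lv) H
        (al : forall j, bop (Hs j) H) xs x,
        (forall j, K (Hs j) (xs j)) ->
        (exists c, forall j, cbbound (xs j) c) ->
        is_dsum al xs x -> K H x &
      forall H L (al : bop H L) y,
        isom al -> K L y -> K H (compress al y)].

(* The weak-* topology of M_n(E) is the point-weak-* topology on bounded sets,
   and weak-* compact sets are bounded. The empty direct sum puts a point in
   K(0) for every K, so nonemptiness is required at a nonzero level. *)
Definition compact_nc_convex (K : gset lv (opcar V)) :=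
  [/\ nc_convex K,
      forall H, exists c, forall x, K H x -> cbbound x c,
      forall H, compact (K H : set {ptws opcar V -> weakstar H}) &
      exists H : lv, (exists xi : H, xi != 0) /\ K H !=set0].

End DualOperatorSpace.

Section NcFunctions.
Variables (R : realType) (Kap : Type) (lv : levels R Kap) (X : Type).
Variable (K : gset lv X).
Arguments K : clear implicits.
Implicit Types H L : lv.

Definition gfun := forall H, K H -> bop H H.

Definition is_ncfun (f : gfun) :=
  (forall (J : Type) (Hs : J -> lv) H
     (al : forall j, bop (Hs j) H) (xs : forall j, K (Hs j)) (x : K H),
     is_dsum al (fun j => set_val (xs j)) (set_val x) ->
     forall j, bcomp (f H x) (al j) = bcomp (al j) (f (Hs j) (xs j))) /\
  (forall H L (u : bop H L) (x : K H) (y : K L), unitary_op u ->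
     set_val x = compress u (set_val y) ->
     f H x = bcomp (adj u) (bcomp (f L y) u)).

Definition is_ncaffine (a : gfun) := is_ncfun a /\
  forall H L (al : bop H L) (x : K H) (y : K L), isom al ->
    set_val x = compress al (set_val y) ->
    a H x = bcomp (adj al) (bcomp (a L y) al).

(* Each K(n) carries the subspace topology of the product topology. *)
Definition weakstar_continuous (f : gfun) := forall H,
  continuous (f H :
    initial_topology (fun x : K H => set_val x : {ptws X -> weakstar H}) ->
    weakstar H).

Definition ustrongstar_continuous (f : gfun) := forall H,
  continuous (f H :
    initial_topology (fun x : K H => set_val x : {ptws X -> ustrongstar H}) ->
    ustrongstar H).

Definition gfun_lin (a : R[i]) (f g : gfun) : gfun :=
  fun H x => a *: f H x + g H x.
Definition gfun_one : gfun := fun H _ => bid H.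
Definition gfun_mul (f g : gfun) : gfun := fun H x => bcomp (f H x) (g H x).
Definition gfun_star (f : gfun) : gfun := fun H x => adj (f H x).

(* The distance of f and g in the supremum norm is at most e. *)
Definition gfun_near (f g : gfun) (e : R[i]) :=
  forall H x, opbound (f H x - g H x) e.

Definition AK : set gfun :=
  [set a | is_ncaffine a /\ weakstar_continuous a].

Definition cstar_closed (S : set gfun) :=
  [/\ forall (a : R[i]) f g, S f -> S g -> S (gfun_lin a f g),
      forall f g, S f -> S g -> S (gfun_mul f g),
      forall f, S f -> S (gfun_star f) &
      forall f, (forall e : R[i], 0 < e -> exists2 g, S g & gfun_near f g e) ->
        S f].

(* The algebra of bounded nc functions is one of the [cstar_closed] sets that
   contain A(K). *)
Definition CK : set gfun := smallest cstar_closed AK.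

Definition linear_on (A : set gfun) (H : hilbert R) (mu : gfun -> bop H H) :=
  forall (a : R[i]) f g, A f -> A g ->
    mu (gfun_lin a f g) = a *: mu f + mu g.

(* The positive elements of M_n(A) are the g^* g with g in M_n(A). *)
Definition gram n (g : 'M[gfun]_n) : 'M[gfun]_n := \matrix_(i, j)
  (fun H x => \sum_k bcomp (adj (g k i H x)) (g k j H x)).

(* For a unital C*-subalgebra A; the values of mu outside A do not matter. *)
Definition is_ucp (A : set gfun) (H : hilbert R) (mu : gfun -> bop H H) :=
  [/\ linear_on A mu,
      mu gfun_one = bid H &
      forall n (g : 'M[gfun]_n), (forall i j, A (g i j)) ->
        mx_psd (map_mx mu (gram g))].

Definition is_star_rep (A : set gfun) (L : hilbert R) (pi : gfun -> bop L L) :=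
  [/\ linear_on A pi,
      pi gfun_one = bid L,
      forall f g, A f -> A g -> pi (gfun_mul f g) = bcomp (pi f) (pi g) &
      forall f, A f -> pi (gfun_star f) = adj (pi f)].

(* H is embedded in L by the isometry W. *)
Definition is_min_stinespring (A : set gfun) (H L : hilbert R)
    (mu : gfun -> bop H H) (pi : gfun -> bop L L) (W : bop H L) :=
  [/\ is_star_rep A pi, isom W,
      forall f, A f -> mu f = bcomp (adj W) (bcomp (pi f) W) &
      cspan [set eta | exists f xi, A f /\ eta = pi f (W xi)] = setT].

Fixpoint word_space (I : Type) (As : I -> set gfun) (L : hilbert R)
    (pi : gfun -> bop L L) (L0 : set L) (w : seq I) : set L :=
  if w is i :: v then
    let Lv := word_space As pi L0 v in
    cspan [set eta | exists f xi, [/\ As i f, Lv xi & eta = pi f xi]]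
      `&` ocompl Lv
  else L0.

Definition reduced_word (I : eqType) (w : seq I) :=
  sorted (fun i j => i != j) w.

(* A is meant to be the free product of its subalgebras [As i]. *)
Definition is_free_product_ucp (I : eqType) (A : set gfun)
    (As : I -> set gfun) (H : hilbert R) (mu : gfun -> bop H H) :=
  is_ucp A mu /\
  exists (L : hilbert R) (pi : gfun -> bop L L) (W : bop H L),
    is_min_stinespring A mu pi W /\
    forall v w : seq I, reduced_word v -> reduced_word w -> v != w ->
      orthogonal_sets (word_space As pi (range W) v)
                      (word_space As pi (range W) w).

Definition is_bar H (mu : gfun -> bop H H) (b : K H) :=
  forall a, AK a -> a H b = mu a.

(* The value mu(f) = al^* f(x) al, where mu(g) = al^* g(x) al on C(K). *)
Definition is_value H (mu : gfun -> bop H H) (f : gfun) (T : bop H H) :=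
  exists (L : lv) (x : K L) (al : bop H L),
    [/\ isom al,
        forall g, CK g -> mu g = bcomp (adj al) (bcomp (g L x) al) &
        T = bcomp (adj al) (bcomp (f L x) al)].

Definition density_le (A : set gfun) := exists D : Kap -> gfun,
  (forall i, A (D i)) /\
  forall f (e : R[i]), A f -> 0 < e -> exists i, gfun_near f (D i) e.

End NcFunctions.
Arguments AK {R Kap lv X} K _.
Arguments CK {R Kap lv X} K _.

Definition opspace_density_le (R : realType) (V : opspace R) (Kap : Type) :=
  exists D : Kap -> opcar V, forall v (e : R[i]), 0 < e ->
    exists i, opbound (opval v - opval (D i)) e.

Section Products.
Variables (R : realType) (Kap : Type) (lv : levels R Kap).
Variables (d : nat) (V : 'I_d -> opspace R).
Variable K : forall i, gset lv (opcar (V i)).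
Arguments K : clear implicits.

Definition prod_index := {i : 'I_d & opcar (V i)}.

Definition coord (T : Type) (i : 'I_d) (x : prod_index -> T) : opcar (V i) -> T :=
  fun e => x (existT _ i e).
Arguments coord {T} i x e.

Definition prodK : gset lv prod_index :=
  fun H => [set x | forall i, K i H (coord i x)].
Arguments prodK : clear implicits.

Lemma coord_prodK (H : lv) (x : prodK H) (i : 'I_d) :
  coord i (set_val x) \in K i H.
Proof. by apply/mem_set; exact: (set_mem (valP x)). Qed.

Definition coord_pt (H : lv) (x : prodK H) (i : 'I_d) : K i H :=
  SigSub (coord_prodK x i).

(* The embedding of C(K_i) in C(K_1 x ... x K_d). *)
Definition pull (i : 'I_d) (g : gfun (K i)) : gfun prodK :=
  fun H x => g H (coord_pt x i).

Definition CK_factor (i : 'I_d) : set (gfun prodK) :=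
  [set pull g | g in CK (K i)].

Definition trivial_dilation (i : 'I_d) (H L : lv) (al : bop H L)
    (y : prod_index -> bop L L) := forall e,
  bcomp (bcomp al (adj al)) (coord i y e) =
  bcomp (coord i y e) (bcomp al (adj al)).

Definition separately_nc_convex (f : gfun prodK) :=
  forall (H L : lv) (al : bop H L) (x : prodK H) (y : prodK L),
    isom al -> set_val x = compress al (set_val y) ->
    (forall i j, ~ trivial_dilation i al (set_val y) ->
                 ~ trivial_dilation j al (set_val y) -> i = j) ->
    ople (f H x) (bcomp (adj al) (bcomp (f L y) al)).

End Products.
Arguments prodK {R Kap lv d V} K H _.
Arguments CK_factor {R Kap lv d V} K i _.

(* Main.v *)
Require Import Defs.
From HB Require Import structures.
From mathcomp Require Import all_boot all_order all_algebra.
From mathcomp Require Import complex.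
From mathcomp Require Import all_classical all_reals all_analysis.
From mathcomp Require Import ring lra.

(** The map mu has the form mu(g) = al^* g(x) al, with x a point of some level
    L. By uniqueness of the minimal Stinespring dilation
    (stinespring_embedding), the spaces L_w of the free product condition
    embed in L as pairwise orthogonal spaces N_w, and the space of the empty
    word becomes the range of al.

    The reduced words are ranked so that suffixes come first and words of
    equal rank share their first letter. Let P_n be the projection of L onto
    the closed span M_n of the N_w of rank at most n. The j-th algebra acts on
    words by adding or removing an initial letter j (word_space_step). So if
    the words of rank n + 1 begin with i, then P_n x_j P_(n+1) = P_n x_j P_n
    for all j different from i (stage_step): from M_n to M_(n+1) the
    compression of x is dilated in the i-th coordinate only, and separate
    convexity applies. The chain M_0, M_1, ... starts at the barycenter b,
    which is the compression of x to M_0. This gives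
    f(b) <= al^* f(z_n) al for the block diagonal part z_n of x with respect
    to M_n and its complement (jensen_stage). The M_n increase to a space that
    reduces x, so the z_n converge to x, boundedly and strongly together with
    their adjoints, hence in each of the two topologies for which f may be
    continuous (ncfun_converges). In the limit f(b) <= al^* f(x) al.

    The chain is realized inside the single level L, without choosing levels
    for the M_n. The block diagonal part of a point z is the average of z and
    U z U, with U the reflection in M_n, and this average is a compression of
    the direct sum of z and U z U along the diagonal isometry of L into two
    copies of L. That dilation is trivial in every coordinate in which U
    commutes with z (averaging). The direct sum of two copies of L is a level
    because an infinite set contains two disjoint copies of itself
    (infinite_doubling).

    What precedes these lemmas is the Hilbert space theory that they rest on:
    projections, the Riesz representation, adjoints, direct sums, isometries
    determined by Gram matrices, and dominated convergence of series. *)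

Set Implicit Arguments.
Unset Strict Implicit.
Unset Printing Implicit Defensive.

Import Order.TTheory GRing.Theory Num.Theory Num.Def.
Import numFieldNormedType.Exports.

Local Open Scope classical_set_scope.
Local Open Scope ring_scope.
Local Open Scope complex_scope.

(** * Completeness and convergence *)

Lemma half_gt0 (F : numFieldType) (e : F) : 0 < e -> 0 < e / 2.
Proof. by move=> e0; rewrite divr_gt0. Qed.

Lemma half_lt (F : numFieldType) (e : F) : 0 < e -> e / 2 < e.
Proof. by move=> e0; rewrite ltr_pdivrMr// mulr_natr mulr2n ltrDl. Qed.

(** The estimates below produce and use convergence of sequences in this
    elementary form, over the reals, the complex numbers and Hilbert spaces
    alike. *)
Definition converges (F : numFieldType) (U : normedModType F) (u : nat -> U) (l : U) :=
  forall e : F, 0 < e -> exists N, forall n, (N <= n)%N -> `|l - u n| <= e.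

Lemma convergesP (F : numFieldType) (U : normedModType F) (u : nat -> U) l :
  converges u l <-> u @ \oo --> l.
Proof.
split=> [ul|/cvgrPdist_le ul e e0]; last first.
  by have [N _ NP] := ul e e0; exists N => n; exact: NP.
by apply/cvgrPdist_le => e /ul[N NP]; exists N => // n; exact: NP.
Qed.

Lemma seq_complete (F : numFieldType) (U : completeNormedModType F) (u : nat -> U) :
  (forall e : F, 0 < e -> exists N, forall m n, (N <= m)%N -> (N <= n)%N ->
     `|u m - u n| <= e) ->
  exists l, converges u l.
Proof.
move=> uC; have : cvg (u @ \oo).
  apply/cauchy_cvgP/cauchy_ballP => e e0.
  have [N NP] := uC (e / 2) (half_gt0 e0).
  exists ([set u n | n in [set n | (N <= n)%N]],
          [set u n | n in [set n | (N <= n)%N]]) => [/=|].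
    by split; exists N => // n /= Nn; exists n.
  move=> [_ _] [/= [m Nm <-] [n Nn <-]]; rewrite -ball_normE/=.
  by rewrite (le_lt_trans (NP _ _ Nm Nn))// half_lt.
by move=> /cvg_ex[l ul]; exists l; exact/convergesP.
Qed.

(** * Inner products and closed subspaces *)

Section HilbertGeometry.
Variables (R : realType) (H : hilbert R).
Implicit Types (x y z : H) (a : R[i]).

Lemma hdotDl x y z : hdot H (x + y) z = hdot H x z + hdot H y z.
Proof. exact: linearDl. Qed.

Lemma hdotBl x y z : hdot H (x - y) z = hdot H x z - hdot H y z.
Proof. exact: linearBl. Qed.

Lemma hdotZl a x z : hdot H (a *: x) z = a * hdot H x z.
Proof. exact: linearZl_LR. Qed.

Lemma hdot0l z : hdot H 0 z = 0. Proof. exact: linear0l. Qed.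

Lemma hdotC x y : hdot H x y = (hdot H y x)^*%R.
Proof. by rewrite (hermC (hdot H)) expr0 mul1r. Qed.

Lemma hdotDr x y z : hdot H z (x + y) = hdot H z x + hdot H z y.
Proof. exact: linearDr. Qed.

Lemma hdotBr x y z : hdot H z (x - y) = hdot H z x - hdot H z y.
Proof. exact: linearBr. Qed.

Lemma hdotZr a x z : hdot H z (a *: x) = a^*%R * hdot H z x.
Proof. exact: linearZr_LR. Qed.

Lemma hdot0r z : hdot H z 0 = 0. Proof. exact: linear0r. Qed.

Lemma hdot_eq0C x y : hdot H x y = 0 -> hdot H y x = 0.
Proof. by move=> xy0; rewrite hdotC xy0 rmorph0. Qed.

Lemma hnormD x y :
  `|x + y| ^+ 2 = `|x| ^+ 2 + `|y| ^+ 2 + (hdot H x y + hdot H y x).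
Proof.
by rewrite !hdotE hdotDl !hdotDr; ring.
Qed.

Lemma hnormB x y :
  `|x - y| ^+ 2 = `|x| ^+ 2 + `|y| ^+ 2 - (hdot H x y + hdot H y x).
Proof.
rewrite hnormD normrN -[- y]scaleN1r hdotZl hdotZr rmorphN rmorph1.
by rewrite !mulN1r -opprD.
Qed.

Lemma parallelogram x y :
  `|x + y| ^+ 2 + `|x - y| ^+ 2 = 2 * (`|x| ^+ 2 + `|y| ^+ 2).
Proof. by rewrite hnormD hnormB addrACA subrr addr0 mulr2n mulrDl mul1r. Qed.

Lemma cauchy_schwarz x y : `|hdot H x y| <= `|x| * `|y|.
Proof.
have [->|y0] := eqVneq y 0; first by rewrite hdot0r !normr0 mulr0.
rewrite -(@ler_pXn2r _ 2)// ?nnegrE ?mulr_ge0// exprMn.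
have yy : 0 < `|y| ^+ 2 by rewrite exprn_gt0// normr_gt0.
set c := hdot H x y.
have yyJ : (`|y| ^+ 2)^*%R = `|y| ^+ 2.
  by apply/CrealP; rewrite ger0_real// exprn_ge0.
have := exprn_ge0 2 (normr_ge0 (`|y| ^+ 2 *: x - c *: y)).
rewrite [X in 0 <= X -> _]hdotE hdotBl !hdotBr !hdotZl !hdotZr -!hdotE (hdotC y x) -/c yyJ.
rewrite [X in 0 <= X](_ : _ = `|y| ^+ 2 * (`|y| ^+ 2 * `|x| ^+ 2 - `|c| ^+ 2)).
  by rewrite pmulr_rge0// subr_ge0 mulrC.
by rewrite normCK; ring.
Qed.

Lemma eq_of_hdot x y : (forall z, hdot H x z = hdot H y z) -> x = y.
Proof.
move=> xy; apply/subr0_eq/eqP; rewrite -normr_eq0 -sqrf_eq0 hdotE.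
by rewrite hdotBl xy subrr.
Qed.

Lemma closedE (S : set H) : closed S <->
  forall x, (forall e : R[i], 0 < e -> exists2 y, S y & `|x - y| <= e) -> S x.
Proof.
split=> [Scl x Sx|SP x clx].
  apply: Scl => B /nbhs_ballP[e e0 eB].
  have [y Sy xy] := Sx (e / 2) (half_gt0 e0).
  exists y; split=> //; apply: eB; rewrite -ball_normE/=.
  by rewrite (le_lt_trans xy)// half_lt.
apply: SP => e e0; have [y [Sy]] := clx _ (nbhsx_ballx x e e0).
by rewrite -ball_normE/= => /ltW xy; exists y.
Qed.

Lemma closed_subspaceE (S : set H) : closed_subspace S <->
  [/\ forall x, (forall e : R[i], 0 < e -> exists2 y, S y & `|x - y| <= e) ->
        S x,
      S 0 & forall a x y, S x -> S y -> S (a *: x + y)].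
Proof. by split=> -[/closedE cl S0 SP]; split. Qed.

Lemma cspanP (A : set H) : closed_subspace (cspan A).
Proof.
rewrite closed_subspaceE; split=> [x xP|M [[_ M0 _] _]//|a x y Ax Ay M [MP AM]].
  move=> M [MP AM]; have [/closedE Mcl _ _] := MP.
  by apply: Mcl => e /xP[y Ay xy]; exists y => //; apply: Ay.
by have [_ _ Ml] := MP; apply: Ml; [apply: Ax|apply: Ay].
Qed.

Lemma sub_cspan (A : set H) : A `<=` cspan A.
Proof. by move=> x Ax M [_]; apply. Qed.

Lemma cspan_sub (A M : set H) : closed_subspace M -> A `<=` M -> cspan A `<=` M.
Proof. by move=> MP AM x; apply. Qed.

End HilbertGeometry.

(** * Bounded operators and orthogonal projections *)

Lemma half_double (R : realType) (H : hilbert R) (x : H) :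
  (2^-1 : R[i]) *: (x + x) = x.
Proof.
rewrite scalerDr -scalerDl (_ : _ + _ = 1) ?scale1r//.
by rewrite [RHS](@splitr R[i] 1) !div1r.
Qed.

Section BoundedOperatorTheory.
Variables (R : realType) (H K : hilbert R).

Lemma bop_linear (T : bop H K) : linear T.
Proof. by have /asboolP[] := bop_funP T. Qed.

HB.instance Definition _ (T : bop H K) :=
  GRing.isLinear.Build R[i] H K *:%R T (bop_linear T).

Lemma bopD (T : bop H K) x y : T (x + y) = T x + T y.
Proof. exact: linearD. Qed.

Lemma bopB (T : bop H K) x y : T (x - y) = T x - T y.
Proof. exact: linearB. Qed.

Lemma bopZ (T : bop H K) a x : T (a *: x) = a *: T x.
Proof. exact: linearZ. Qed.

Lemma bop0 (T : bop H K) : T 0 = 0.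
Proof. exact: linear0. Qed.

Lemma bop_bound (T : bop H K) :
  exists2 c : R[i], 0 < c & forall x, `|T x| <= c * `|x|.
Proof.
have /asboolP[_ [c cP]] := bop_funP T; exists (`|c| + 1) => [|x].
  by rewrite ltr_wpDl.
have [->|x0] := eqVneq x 0; first by rewrite linear0 !normr0 mulr0.
have cx : 0 <= c * `|x| by rewrite (le_trans _ (cP x)).
rewrite (le_trans (cP x))// -(ger0_norm cx) normrM normr_id.
by rewrite ler_wpM2r// lerDl.
Qed.

Lemma bop_ext (S T : bop H K) : (forall x, S x = T x) -> S = T.
Proof. by move=> ST; apply/val_inj/funext. Qed.

Lemma bopDE (S T : bop H K) x : (S + T) x = S x + T x.
Proof. by []. Qed.

Lemma bopBE (S T : bop H K) x : (S - T) x = S x - T x.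
Proof. by []. Qed.

Lemma bopZE a (T : bop H K) x : (a *: T) x = a *: T x.
Proof. by []. Qed.

Lemma bop0E x : (0 : bop H K) x = 0.
Proof. by []. Qed.

Definition mkbop (f : H -> K) (fl : linear f)
  (fb : exists c : R[i], forall x, `|f x| <= c * `|x|) : bop H K :=
  Bop (introT (asboolP _) (conj fl fb)).

(** Kernels, equalizers and annihilators of bounded operators have this form,
    so an identity between operators holds on a closed span as soon as it
    holds on the generators. *)
Lemma closed_subspace_preim (T : bop H K) (M : set K) :
  closed_subspace M -> closed_subspace [set x | M (T x)].
Proof.
move=> /closed_subspaceE[Mcl M0 Ml]; apply/closed_subspaceE; split=> /=.
- move=> x xP; apply: Mcl => e e0; have [c c0 cP] := bop_bound T.
  have [y My xy] := xP (e / c) (divr_gt0 e0 c0); exists (T y) => //.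
  by rewrite -linearB (le_trans (cP _))// mulrC -ler_pdivlMr.
- by rewrite linear0.
- by move=> a x y Mx My; rewrite linearP; apply: Ml.
Qed.

Lemma closed_subspace0 : closed_subspace [set 0 : H].
Proof.
apply/closed_subspaceE; split=> //= [x xP|a x y -> ->]; last first.
  by rewrite scaler0 addr0.
apply/eqP; rewrite -normr_le0; apply/ler_addgt0Pr => e /xP[_ ->].
by rewrite subr0 add0r.
Qed.

Lemma closed_subspace_ortho (A : set H) : closed_subspace (ocompl A).
Proof.
apply/closed_subspaceE; split=> [x xP z Az|z _|a x y Ax Ay z Az].
- apply/eqP; rewrite -normr_le0; apply/ler_addgt0Pr => e e0; rewrite add0r.
  have z0 : 0 < `|z| + 1 by rewrite ltr_wpDl.
  have [y Ay xy] := xP _ (divr_gt0 e0 z0).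
  rewrite -[hdot H x z](subr0) -(Ay z Az) -hdotBl (le_trans (cauchy_schwarz _ _))//.
  rewrite (le_trans (ler_wpM2r _ xy))// -mulrA ler_piMr ?(ltW e0)//.
  by rewrite mulrC ler_pdivrMr// mul1r lerDl.
- by rewrite hdot0l.
- by rewrite hdotDl hdotZl Ax// Ay// mulr0 addr0.
Qed.

Lemma closed_subspaceD (M : set H) x y :
  closed_subspace M -> M x -> M y -> M (x + y).
Proof. by move=> [_ _ Ml] Mx My; rewrite -[x]scale1r; apply: Ml. Qed.

Lemma closed_subspaceZ (M : set H) a x :
  closed_subspace M -> M x -> M (a *: x).
Proof. by move=> [_ M0 Ml] Mx; rewrite -[a *: x]addr0; apply: Ml. Qed.

Lemma closed_subspaceB (M : set H) x y :
  closed_subspace M -> M x -> M y -> M (x - y).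
Proof.
by move=> MP Mx My; rewrite -scaleN1r addrC; case: (MP) => _ _; apply.
Qed.

Lemma closed_subspaceI (M N : set H) :
  closed_subspace M -> closed_subspace N -> closed_subspace (M `&` N).
Proof.
move=> [Mc M0 Ml] [Nc N0 Nl]; split=> //; first exact: closedI.
by move=> a x y [Mx Nx] [My Ny]; split; [exact: Ml|exact: Nl].
Qed.

End BoundedOperatorTheory.

Section Projection.
Variables (R : realType) (H : hilbert R) (M : set H).
Hypothesis MP : closed_subspace M.

Let nrm2 (x : H) : R := complex.Re (`|x| ^+ 2).

Let nrm2E x : `|x| ^+ 2 = (nrm2 x)%:C.
Proof. by rewrite RRe_real// ger0_real// exprn_ge0. Qed.

(** A minimizing sequence is Cauchy: midpoints of its terms lie in M, hence
    are not nearer to x than the infimum, and the parallelogram law bounds the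
    distance of the two terms. *)
Lemma nearest_point x : exists2 m, M m & forall y, M y -> `|x - m| <= `|x - y|.
Proof.
have [_ M0 _] := MP.
pose D := [set nrm2 (x - y) | y in M].
have D0 : D !=set0 by exists (nrm2 (x - 0)); exists 0.
have Dlb : has_lbound D.
  by exists 0 => _ [y _ <-]; rewrite -lecR -nrm2E exprn_ge0.
have dle y : M y -> inf D <= nrm2 (x - y) by move=> My; apply: ge_inf => //; exists y.
have /choice[m mP] : forall n, exists y, M y /\ nrm2 (x - y) < inf D + n.+1%:R^-1.
  move=> n; have n0 : 0 < n.+1%:R^-1 :> R by rewrite invr_gt0 ltr0n.
  by have [_ [y My <-] yD] := inf_adherent n0 (conj D0 Dlb); exists y.
have close (e : R) y z : M y -> M z -> nrm2 (x - y) < inf D + e ->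
    nrm2 (x - z) < inf D + e -> nrm2 (y - z) <= 4 * e.
  move=> My Mz yD zD.
  have My2 : M ((2^-1 : R[i]) *: (y + z)).
    by apply: closed_subspaceZ => //; apply: closed_subspaceD.
  have := dle _ My2; have := parallelogram (x - z) (x - y).
  have -> : x - z + (x - y) = (2 : R[i]) *: (x - (2^-1 : R[i]) *: (y + z)).
    rewrite scalerBr scalerA divff ?pnatr_eq0// scale1r scaler_nat mulr2n.
    by rewrite addrACA -opprD (addrC z).
  have -> : x - z - (x - y) = y - z.
    by rewrite opprB addrC addrA subrK.
  rewrite normrZ exprMn !nrm2E normr_nat -natrX -!(rmorph_nat (@real_complex R)).
  rewrite -!rmorphM -!rmorphD -rmorphM => /complexI; lra.
have /seq_complete[l lP] : forall e : R[i], 0 < e -> exists N, forall p n,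
    (N <= p)%N -> (N <= n)%N -> `|m p - m n| <= e.
  move=> e e0; have eR := gtr0_real e0; have e2 : 0 < complex.Re e ^+ 2 / 4.
    by rewrite divr_gt0// exprn_gt0// -ltcR RRe_real.
  have [N _ NP] := near_infty_natSinv_lt (PosNum e2).
  exists N => p n Np Nn; rewrite -(@ler_pXn2r _ 2) ?nnegrE ?(ltW e0)// nrm2E.
  rewrite -(RRe_real eR) -rmorphXn lecR.
  have [[Mp pD] [Mn nD]] := (mP p, mP n).
  rewrite (le_trans (close (complex.Re e ^+ 2 / 4) _ _ Mp Mn _ _))//.
  - by rewrite (lt_trans pD)// ltrD2l; apply: NP.
  - by rewrite (lt_trans nD)// ltrD2l; apply: NP.
  - by rewrite mulrC divfK// pnatr_eq0.
exists l.
  have /closed_subspaceE[Mc _ _] := MP; apply: Mc => e /lP[N NP].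
  by exists (m N); [case: (mP N)|apply: NP].
move=> y My; apply/ler_addgt0Pr => e e0.
have e3 := half_gt0 e0; have eR := gtr0_real e3.
have e2 : 0 < complex.Re (e / 2) ^+ 2 by rewrite exprn_gt0// -ltcR RRe_real.
have [N1 _ N1P] := near_infty_natSinv_lt (PosNum e2).
have [N2 N2P] := lP _ e3; pose n := maxn N1 N2.
have -> : x - l = (x - m n) + (m n - l) by rewrite addrA subrK.
rewrite (le_trans (ler_normD _ _))//.
rewrite [leRHS](_ : _ = `|x - y| + e / 2 + e / 2); last first.
  by rewrite {1}(splitr e) addrA.
rewrite lerD//; last by rewrite distrC N2P// leq_maxr.
rewrite -(@ler_pXn2r _ 2) ?nnegrE ?addr_ge0 ?(ltW e3)// sqrrD.
(* The infimum concerns squared distances: m n exceeds it by less than (e /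
   2)^2, and (|x - y| + e / 2)^2 leaves that much room. *)
rewrite (@le_trans _ _ (`|x - y| ^+ 2 + (e / 2) ^+ 2))//; last first.
  by rewrite lerD2r lerDl mulrn_wge0// mulr_ge0// (ltW e3).
rewrite !nrm2E -(RRe_real eR) -rmorphXn -rmorphD lecR ltW//.
have [_ /lt_trans] := mP n; apply; rewrite ler_ltD ?dle//.
by apply: N1P; rewrite /= leq_maxl.
Qed.

(** Moving the nearest point along y by <x - m, y> / |y|^2 would bring it
    nearer to x, by |<x - m, y>|^2 / |y|^2. *)
Lemma projection_exists x : exists2 m, M m & forall y, M y -> hdot H (x - m) y = 0.
Proof.
have [m Mm mP] := nearest_point x; exists m => // y My.
have [->|y0] := eqVneq y 0; first by rewrite hdot0r.
have yy : 0 < `|y| ^+ 2 by rewrite exprn_gt0// normr_gt0.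
set c := hdot H (x - m) y; pose t := c / `|y| ^+ 2.
have := mP (m + t *: y) (closed_subspaceD MP Mm (closed_subspaceZ t MP My)).
have tJ : t^*%R = c^*%R / `|y| ^+ 2.
  rewrite /t rmorphM fmorphV; congr (_ / _).
  by apply/CrealP; rewrite ger0_real// ltW.
rewrite opprD addrA -(@ler_pXn2r _ 2) ?nnegrE// [leRHS]hnormB -[leRHS]addrA lerDl.
rewrite normrZ exprMn hdotZr hdotZl (hdotC y) -/c normrM normfV.
rewrite (ger0_norm (ltW yy)) tJ /t.
rewrite [X in 0 <= X](_ : _ = - (`|c| ^+ 2 / `|y| ^+ 2)); last first.
  by rewrite exprMn normCK; field; rewrite -sqrf_eq0 gt_eqF.
rewrite oppr_ge0 pmulr_lle0 ?invr_gt0// => c2.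
by apply/eqP; rewrite -normr_eq0 -sqrf_eq0 eq_le c2 exprn_ge0.
Qed.
End Projection.

Section Riesz.
Variables (R : realType) (H : hilbert R).

(** Chosen as a whole operator, in the way adj is; meaningful for closed
    subspaces. *)
Definition proj (M : set H) : bop H H := xget 0
  [set P : bop H H | forall x, M (P x) /\
     forall y, M y -> hdot H (x - P x) y = 0].

Lemma proj_unique (M : set H) x m m' : closed_subspace M -> M m -> M m' ->
  (forall y, M y -> hdot H (x - m) y = 0) ->
  (forall y, M y -> hdot H (x - m') y = 0) -> m = m'.
Proof.
move=> MP Mm Mm' mP m'P; apply/subr0_eq/eqP; rewrite -normr_eq0 -sqrf_eq0 hdotE.
have Md : M (m - m') by exact: closed_subspaceB.
rewrite [X in hdot H X _](_ : _ = (x - m') - (x - m)); last first.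
  by rewrite opprB [RHS]addrC addrA subrK.
by rewrite hdotBl m'P// mP// subrr.
Qed.

Lemma projP (M : set H) : closed_subspace M -> forall x, M (proj M x) /\
  forall y, M y -> hdot H (x - proj M x) y = 0.
Proof.
move=> MP.
suff [P PP] : exists P : bop H H, forall x, M (P x) /\
    forall y, M y -> hdot H (x - P x) y = 0.
  by rewrite /proj; case: xgetP => [Q _ //|/(_ P)]; case.
have /choice[p pP] : forall x, exists m, M m /\
    forall y, M y -> hdot H (x - m) y = 0.
  by move=> x; have [m] := projection_exists MP x; exists m.
have pl : linear p.
  move=> a x y; have [[Mx xP] [My yP]] := (pP x, pP y).
  have [Mxy xyP] := pP (a *: x + y).
  apply: (proj_unique MP Mxy _ xyP) => [|z Mz].
    by apply: closed_subspaceD => //; exact: closed_subspaceZ.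
  by rewrite opprD addrACA -scalerBr hdotDl hdotZl xP// yP// mulr0 addr0.
have pb : exists c : R[i], forall x, `|p x| <= c * `|x|.
  exists 1 => x; have [Mx xP] := pP x; rewrite mul1r.
  rewrite -(@ler_pXn2r _ 2) ?nnegrE// -[in leRHS](subrK (p x) x) hnormD.
  by rewrite (hdotC (p x)) xP// rmorph0 !addr0 lerDr exprn_ge0.
by exists (mkbop pl pb).
Qed.

(** The kernel of phi has a one-dimensional complement, spanned by u; both
    sides vanish on the kernel and agree at u. *)
Lemma riesz (phi : H -> R[i]) (c : R[i]) :
  (forall a x y, phi (a *: x + y) = a * phi x + phi y) ->
  (forall x, `|phi x| <= c * `|x|) ->
  exists u, forall x, phi x = hdot H x u.
Proof.
move=> phil phib.
have phi0 : phi 0 = 0.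
  by have := phil (- 1) 0 0; rewrite scaler0 addr0 mulN1r addNr.
have [ph0|/existsNP[z /eqP z0]] := pselect (forall x, phi x = 0).
  by exists 0 => x; rewrite hdot0r ph0.
have c0 : 0 < `|c| + 1 by rewrite ltr_wpDl.
have {}phib x : `|phi x| <= (`|c| + 1) * `|x|.
  rewrite (le_trans (phib x))//.
  have cx : 0 <= c * `|x| by rewrite (le_trans _ (phib x)).
  by rewrite -(ger0_norm cx) normrM normr_id ler_wpM2r// lerDl.
have KP : closed_subspace [set x | phi x = 0].
  apply/closed_subspaceE; split=> //= [x xP|a x y x0 y0].
    apply/eqP; rewrite -normr_le0; apply/ler_addgt0Pr => e e0; rewrite add0r.
    have [y y0 xy] := xP _ (divr_gt0 e0 c0).
    rewrite (_ : phi x = phi (x - y)); last first.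
      by rewrite addrC -scaleN1r phil y0 mulr0 add0r.
    by rewrite (le_trans (phib _))// mulrC -ler_pdivlMr.
  by rewrite phil x0 y0 mulr0 addr0.
have [p p0 pP] := projection_exists KP z.
pose u := z - p.
have phiu : phi u = phi z by rewrite /u addrC -scaleN1r phil p0 mulr0 add0r.
have u0 : u != 0.
  by apply: contra z0 => /eqP uE; rewrite -phiu uE phi0.
have uu : `|u| ^+ 2 != 0 by rewrite sqrf_eq0 normr_eq0.
exists (((phi u)^*%R / `|u| ^+ 2) *: u) => x.
have E : hdot H u (- (phi x / phi u) *: u + x) = 0.
  by apply: pP; rewrite /= phil mulNr divfK ?addNr// phiu.
have {}E : hdot H x u = phi x / phi u * `|u| ^+ 2.
  apply/subr0_eq; rewrite -[RHS](hdot_eq0C E) hdotDl hdotZl -hdotE.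
  by rewrite mulNr addrC.
have uJ : ((phi u)^*%R / `|u| ^+ 2)^*%R = phi u / `|u| ^+ 2.
  rewrite rmorphM fmorphV; congr (_ / _); first exact: conjCK.
  by apply/CrealP; rewrite ger0_real// exprn_ge0.
rewrite hdotZr uJ E; field; rewrite phiu z0 /=.
by rewrite normr_eq0.
Qed.

End Riesz.

(** * Adjoints and isometries *)

Section Adjoint.
Variable R : realType.
Implicit Types H K L : hilbert R.

(** The Riesz representative of x |-> <T x, y> depends linearly and boundedly
    on y. *)
Lemma adjP H K (T : bop H K) x y : hdot K (T x) y = hdot H x (adj T y).
Proof.
move: x y; suff [S SP] : exists S : bop K H,
    forall x y, hdot K (T x) y = hdot H x (S y).
  by rewrite /adj; case: xgetP => [S' _ //|/(_ S)]; case.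
have [c c0 cP] := bop_bound T.
have /choice[s sP] : forall y, exists u, forall x, hdot K (T x) y = hdot H x u.
  move=> y; apply: (@riesz _ _ _ (c * `|y|)) => [a u v|x].
    by rewrite linearP hdotDl hdotZl.
  by rewrite (le_trans (cauchy_schwarz _ _))// mulrAC ler_wpM2r.
have sl : linear s.
  move=> a u v; apply: eq_of_hdot => z; rewrite [LHS]hdotC -sP.
  by rewrite [RHS]hdotC !hdotDr !hdotZr -!sP.
have sb : exists e : R[i], forall y, `|s y| <= e * `|y|.
  exists c => y; have [->|sy0] := eqVneq (s y) 0.
    by rewrite normr0 mulr_ge0// ltW.
  have sy : 0 < `|s y| by rewrite normr_gt0.
  rewrite -(ler_pM2r sy) -expr2.
  have -> : `|s y| ^+ 2 = `|hdot K (T (s y)) y|.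
    by rewrite sP -hdotE ger0_norm// exprn_ge0.
  by rewrite (le_trans (cauchy_schwarz _ _))// mulrAC ler_wpM2r.
by exists (mkbop sl sb).
Qed.

Lemma adjPr H K (T : bop H K) x y : hdot K y (T x) = hdot H (adj T y) x.
Proof. by rewrite hdotC adjP -hdotC. Qed.

Lemma adj_eq H K (T : bop H K) (S : bop K H) :
  (forall x y, hdot K (T x) y = hdot H x (S y)) -> adj T = S.
Proof.
move=> TS; apply: bop_ext => y; apply: eq_of_hdot => x.
by rewrite [LHS]hdotC -adjP TS -hdotC.
Qed.

Lemma adj_comp H K L (S : bop K L) (T : bop H K) :
  adj (bcomp S T) = bcomp (adj T) (adj S).
Proof. by apply: adj_eq => x y /=; rewrite -!adjP. Qed.

Lemma adj_id H : adj (bid H) = bid H.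
Proof. exact: adj_eq. Qed.

Lemma adjD H K (S T : bop H K) : adj (S + T) = adj S + adj T.
Proof. by apply: adj_eq => x y; rewrite bopDE hdotDl hdotDr !adjP. Qed.

Lemma adjZ H K (a : R[i]) (T : bop H K) : adj (a *: T) = a^*%R *: adj T.
Proof. by apply: adj_eq => x y; rewrite bopZE hdotZl hdotZr conjCK adjP. Qed.

Lemma adjB H K (S T : bop H K) : adj (S - T) = adj S - adj T.
Proof. by apply: adj_eq => x y; rewrite bopBE hdotBl hdotBr !adjP. Qed.

Lemma adj_bound H K (T : bop H K) (c : R[i]) :
  0 <= c -> opbound T c -> opbound (adj T) c.
Proof.
move=> c0 cP y; have [->|sy0] := eqVneq (adj T y) 0.
  by rewrite normr0 mulr_ge0.
have sy : 0 < `|adj T y| by rewrite normr_gt0.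
rewrite -(ler_pM2r sy) -expr2.
have -> : `|adj T y| ^+ 2 = `|hdot K (T (adj T y)) y|.
  by rewrite adjP -hdotE ger0_norm// exprn_ge0.
by rewrite (le_trans (cauchy_schwarz _ _))// mulrAC ler_wpM2r.
Qed.

(** Polarization: testing with x and with i x recovers the real and the
    imaginary part of an inner product from norms. *)
Lemma isom_dot H K (T : bop H K) x y :
  isom T -> hdot K (T x) (T y) = hdot H x y.
Proof.
move=> Ti.
have E z : hdot K (T z) (T y) + hdot K (T y) (T z) = hdot H z y + hdot H y z.
  by have := Ti (z + y); rewrite linearD => /(congr1 (fun u => u ^+ 2));
     rewrite !hnormD !Ti => /addrI.
have E1 := E x; have := E ('i *: x).
rewrite linearZ !hdotZl !hdotZr conjCi !mulNr -!mulrBr => /(mulfI (neq0Ci _)) E2.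
have : 2 * hdot K (T x) (T y) = 2 * hdot H x y.
  have dbl (a b : R[i]) : 2 * a = (a + b) + (a - b) by ring.
  by rewrite (dbl _ (hdot K (T y) (T x))) E1 E2 -dbl.
by apply: mulfI; rewrite pnatr_eq0.
Qed.

Lemma adj_isom H K (T : bop H K) : isom T -> bcomp (adj T) T = bid H.
Proof.
move=> Ti; apply: bop_ext => x; apply: eq_of_hdot => y /=.
by rewrite -adjPr isom_dot.
Qed.

Lemma adj_isomE H K (T : bop H K) x : isom T -> adj T (T x) = x.
Proof. by move=> /adj_isom/(congr1 (fun S : bop H H => S x)). Qed.

End Adjoint.

(** * Direct sums of Hilbert spaces *)

Section HilbertSum.
Variables (R : realType) (H K : hilbert R).

(** The product already carries the supremum norm; this copy of it receives
    the Euclidean one. *)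
Definition hsum : Type := (H * K)%type.

HB.instance Definition _ := GRing.Lmodule.copy hsum (H * K)%type.

Definition hsum_norm (p : hsum) : R[i] := sqrtC (`|p.1| ^+ 2 + `|p.2| ^+ 2).

Let sq_ge0 (p : hsum) : 0 <= `|p.1| ^+ 2 + `|p.2| ^+ 2.
Proof. by rewrite addr_ge0// exprn_ge0. Qed.

Let hsum_norm_ge0 p : 0 <= hsum_norm p.
Proof. by rewrite sqrtC_ge0. Qed.

Lemma hsum_normD (p q : hsum) :
  hsum_norm (p + q) <= hsum_norm p + hsum_norm q.
Proof.
rewrite -(@ler_pXn2r _ 2) ?nnegrE ?addr_ge0// sqrrD !sqrtCK.
pose a := `|p.1|; pose b := `|p.2|; pose c := `|q.1|; pose e := `|q.2|.
have [a0 b0 c0 e0] : [/\ 0 <= a, 0 <= b, 0 <= c & 0 <= e] by split; exact: normr_ge0.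
apply: (@le_trans _ _ ((a + c) ^+ 2 + (b + e) ^+ 2)).
  by apply: lerD; rewrite ler_pXn2r ?nnegrE ?addr_ge0//; exact: ler_normD.
have st : a * c + b * e <= hsum_norm p * hsum_norm q.
  rewrite -(@ler_pXn2r _ 2) ?nnegrE ?mulr_ge0 ?addr_ge0 ?mulr_ge0//.
  rewrite exprMn !sqrtCK -subr_ge0.
  rewrite [X in 0 <= X](_ : _ = (a * e - b * c) ^+ 2); last first.
    by rewrite /a /b /c /e; ring.
  by rewrite real_exprn_even_ge0// rpredB// rpredM// normr_real.
rewrite [leLHS](_ : _ = a ^+ 2 + b ^+ 2 + (a * c + b * e) *+ 2 +
  (c ^+ 2 + e ^+ 2)); last by ring.
by rewrite lerD2r lerD2l lerMn2r.
Qed.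

Lemma hsum_normZ (a : R[i]) (p : hsum) : hsum_norm (a *: p) = `|a| * hsum_norm p.
Proof.
rewrite /hsum_norm !normrZ !exprMn -mulrDr rootCMl ?exprn_ge0//.
by rewrite sqrCK.
Qed.

Lemma hsum_norm_eq0 (p : hsum) : hsum_norm p = 0 -> p = 0.
Proof.
case: p => x y /eqP; rewrite sqrtC_eq0/= paddr_eq0 ?exprn_ge0// !sqrf_eq0 !normr_eq0.
by move=> /andP[/eqP -> /eqP ->].
Qed.

HB.instance Definition _ :=
  Lmodule_isNormed.Build R[i] hsum hsum_normD hsum_normZ hsum_norm_eq0.

Lemma hsum_normE (p : hsum) : `|p| = hsum_norm p. Proof. by []. Qed.

Lemma hsum_sqE (p : hsum) : `|p| ^+ 2 = `|p.1| ^+ 2 + `|p.2| ^+ 2.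
Proof. by rewrite hsum_normE sqrtCK. Qed.

Lemma hsum_le1 (p : hsum) : `|p.1| <= `|p|.
Proof. by rewrite -(@ler_pXn2r _ 2) ?nnegrE// hsum_sqE lerDl exprn_ge0. Qed.

Lemma hsum_le2 (p : hsum) : `|p.2| <= `|p|.
Proof. by rewrite -(@ler_pXn2r _ 2) ?nnegrE// hsum_sqE lerDr exprn_ge0. Qed.

Lemma hsum_leD (p : hsum) : `|p| <= `|p.1| + `|p.2|.
Proof.
rewrite -(@ler_pXn2r _ 2) ?nnegrE ?addr_ge0// hsum_sqE sqrrD.
by rewrite addrAC lerDl mulrn_wge0// mulr_ge0.
Qed.

Lemma hsum_complete (F : set_system hsum) : ProperFilter F -> cauchy F -> cvg F.
Proof.
move=> FF /cauchyP Fc.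
have F1 : cvg (fst @ F : set_system H).
  apply/cauchy_cvgP/cauchyP => e e0; have [p Fp] := Fc e e0.
  exists p.1; change (F (fst @^-1` ball p.1 e)).
  apply: filterS Fp => q; rewrite /= -!ball_normE/=; apply: le_lt_trans.
  exact: (hsum_le1 (p - q)).
have F2 : cvg (snd @ F : set_system K).
  apply/cauchy_cvgP/cauchyP => e e0; have [p Fp] := Fc e e0.
  exists p.2; change (F (snd @^-1` ball p.2 e)).
  apply: filterS Fp => q; rewrite /= -!ball_normE/=; apply: le_lt_trans.
  exact: (hsum_le2 (p - q)).
move: F1 F2 => /cvg_ex[l1 /cvgrPdist_le l1P] /cvg_ex[l2 /cvgrPdist_le l2P].
apply/cvg_ex; exists (l1, l2); apply/cvgrPdist_le => e e0.
have e2 := half_gt0 e0; apply: filterS2 (l1P _ e2) (l2P _ e2) => p p1 p2.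
rewrite (splitr e) (le_trans (hsum_leD _))//; exact: lerD.
Qed.

HB.instance Definition _ := Uniform_isComplete.Build hsum hsum_complete.

Definition hsum_dot (p q : hsum) : R[i] := hdot H p.1 q.1 + hdot K p.2 q.2.

Lemma hsum_dot_bilinear : bilinear_for *%R (conjC \; *%R) hsum_dot.
Proof.
split=> [q a p p'|p a q q']; rewrite /hsum_dot /=.
  by rewrite !hdotDl !hdotZl; ring.
by rewrite !hdotDr !hdotZr; ring.
Qed.

HB.instance Definition _ := bilinear_isBilinear.Build R[i] hsum hsum R[i]
  *%R (conjC \; *%R) hsum_dot hsum_dot_bilinear.

Lemma hsum_dot_hermitian (p q : hsum) :
  hsum_dot p q = (-1) ^+ false * (hsum_dot q p)^*%R.
Proof. by rewrite expr0 mul1r /hsum_dot (hdotC p.1) (hdotC p.2) -rmorphD. Qed.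

HB.instance Definition _ := isHermitianSesquilinear.Build R[i] hsum false
  conjC hsum_dot hsum_dot_hermitian.

Lemma hsum_dot_gt0 (p : hsum) : p != 0 -> 0 < hsum_dot p p.
Proof.
by move=> p0; rewrite /hsum_dot -!hdotE -hsum_sqE exprn_gt0// normr_gt0.
Qed.

HB.instance Definition _ := isDotProduct.Build R[i] hsum hsum_dot hsum_dot_gt0.

Lemma hsum_dotE (p : hsum) : `|p| ^+ 2 = hsum_dot p p.
Proof. by rewrite hsum_sqE !hdotE. Qed.

End HilbertSum.

Lemma norm_preserving_bounded (R : realType) (H K : hilbert R) (f : H -> K) :
  (forall x, `|f x| = `|x|) -> exists c : R[i], forall x, `|f x| <= c * `|x|.
Proof. by move=> fi; exists 1 => x; rewrite mul1r fi. Qed.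

Section HilbertSumMaps.
Variables (R : realType) (H K : hilbert R).

Definition hilbert_hsum : hilbert R :=
  @Hilbert R (hsum H K) (@hsum_dot R H K) (@hsum_dotE R H K).

Lemma hinl_linear : linear (fun x : H => (x, 0) : hilbert_hsum).
Proof.
move=> a x y; rewrite [LHS](_ : _ = (a *: x + y, a *: 0 + 0))//.
by rewrite scaler0 addr0.
Qed.

Lemma hinr_linear : linear (fun x : K => (0, x) : hilbert_hsum).
Proof.
move=> a x y; rewrite [LHS](_ : _ = (a *: 0 + 0, a *: x + y))//.
by rewrite scaler0 addr0.
Qed.

Lemma hinl_norm x : `|(x, 0) : hilbert_hsum| = `|x|.
Proof.
by rewrite [LHS]hsum_normE /hsum_norm/= normr0 expr0n/= addr0 sqrCK.
Qed.

Lemma hinr_norm x : `|(0, x) : hilbert_hsum| = `|x|.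
Proof.
by rewrite [LHS]hsum_normE /hsum_norm/= normr0 expr0n/= add0r sqrCK.
Qed.

Definition hinl : bop H hilbert_hsum := mkbop hinl_linear
  (norm_preserving_bounded hinl_norm).

Definition hinr : bop K hilbert_hsum := mkbop hinr_linear
  (norm_preserving_bounded hinr_norm).

Lemma hinl_isom : isom hinl. Proof. exact: hinl_norm. Qed.

Lemma hinr_isom : isom hinr. Proof. exact: hinr_norm. Qed.

Lemma hsum_dot_def (p q : hilbert_hsum) :
  hdot hilbert_hsum p q = hdot H p.1 q.1 + hdot K p.2 q.2.
Proof. by []. Qed.

Lemma hinlr_ortho x y : hdot hilbert_hsum (hinl x) (hinr y) = 0.
Proof. by rewrite hsum_dot_def/= hdot0l hdot0r addr0. Qed.

Lemma adj_hinl p : adj hinl p = p.1.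
Proof.
apply: eq_of_hdot => z; rewrite -adjPr hsum_dot_def/=.
by rewrite hdot0r addr0.
Qed.

Lemma adj_hinr p : adj hinr p = p.2.
Proof.
apply: eq_of_hdot => z; rewrite -adjPr hsum_dot_def/=.
by rewrite hdot0r add0r.
Qed.

Lemma hsum_split (p : hilbert_hsum) : p = hinl p.1 + hinr p.2.
Proof.
case: p => x y; rewrite [RHS](_ : _ = (x + 0, 0 + y))//.
by rewrite addr0 add0r.
Qed.

End HilbertSumMaps.

Lemma invn_small (R : realType) (e : R[i]) : 0 < e ->
  exists N, forall n, (N <= n)%N -> n.+1%:R^-1 <= e.
Proof.
move=> e0; have eR := gtr0_real e0.
have e1 : 0 < complex.Re e by rewrite -ltcR RRe_real.
have [N _ NP] := near_infty_natSinv_lt (PosNum e1).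
exists N => n Nn; rewrite -(RRe_real eR) -(rmorph_nat (@real_complex R)) -fmorphV.
by rewrite lecR ltW//; exact: NP.
Qed.

(** T is bounded below on M, so preimages in M of a convergent sequence form a
    Cauchy sequence. *)
Lemma closed_subspace_image (R : realType) (H K : hilbert R) (T : bop H K)
    (M : set H) (c : R[i]) : 0 < c -> closed_subspace M ->
  (forall x, M x -> `|x| <= c * `|T x|) -> closed_subspace (T @` M).
Proof.
move=> c0 MP cP; apply/closed_subspaceE; have [_ M0 Ml] := MP; split; last 2 first.
- by exists 0; rewrite ?linear0.
- move=> a _ _ [x Mx <-] [y My <-]; exists (a *: x + y); first exact: Ml.
  by rewrite linearP.
move=> y yP.
have /choice[u uP] : forall n, exists x, M x /\ `|y - T x| <= n.+1%:R^-1.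
  move=> n; have [|_ [x Mx <-] xy] := yP n.+1%:R^-1; last by exists x.
  by rewrite invr_gt0 ltr0n.
have [l lP] : exists l, converges u l.
  apply: seq_complete => e e0.
  have [N NP] := invn_small (divr_gt0 (half_gt0 e0) c0).
  exists N => m n Nm Nn; have [[Mm mP] [Mn nP]] := (uP m, uP n).
  rewrite (le_trans (cP _ (closed_subspaceB MP Mm Mn)))// mulrC -ler_pdivlMr//.
  rewrite linearB (_ : T (u m) - T (u n) = (y - T (u n)) - (y - T (u m))); last first.
    by rewrite opprB [RHS]addrC addrA subrK.
  rewrite (le_trans (ler_normB _ _))// (splitr (e / c)) lerD//.
    by rewrite (le_trans nP)// (le_trans (NP _ Nn))// mulrAC.
  by rewrite (le_trans mP)// (le_trans (NP _ Nm))// mulrAC.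
have Ml' : M l.
  have /closed_subspaceE[Mc _ _] := MP; apply: Mc => e /lP[N NP].
  by exists (u N); [case: (uP N)|apply: NP].
exists l => //; apply/esym/subr0_eq/eqP; rewrite -normr_le0; apply/ler_addgt0Pr => e e0.
rewrite add0r; have [b b0 bP] := bop_bound T.
have [N1 N1P] := invn_small (half_gt0 e0).
have [N2 N2P] := lP _ (divr_gt0 (half_gt0 e0) b0).
pose n := maxn N1 N2; have [_ nP] := uP n.
have -> : y - T l = (y - T (u n)) - T (l - u n).
  by rewrite linearB opprB addrA subrK.
rewrite (le_trans (ler_normB _ _))// (splitr e) lerD//.
  by rewrite (le_trans nP)// N1P// leq_maxl.
by rewrite (le_trans (bP _))// mulrC -ler_pdivlMr// N2P// leq_maxr.
Qed.

(** The closed span G of the pairs (u i, v i) in the direct sum is the graph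
    of T. The Gram condition equates the inner products of first and of second
    coordinates on G, so the first coordinate determines the second; the first
    coordinates form a closed space because the projection to them is bounded
    below on G. *)
Lemma gram_isometry (R : realType) (H K : hilbert R) (I : Type)
    (u : I -> H) (v : I -> K) :
  (forall i j, hdot H (u i) (u j) = hdot K (v i) (v j)) ->
  cspan (range u) = setT ->
  exists2 T : bop H K, isom T & forall i, T (u i) = v i.
Proof.
move=> uv uT; pose G : set (hilbert_hsum H K) :=
  cspan (range (fun i => (u i, v i) : hilbert_hsum H K)).
have GP : closed_subspace G by exact: cspanP.
have Gdot p q : G p -> G q -> hdot H p.1 q.1 = hdot K p.2 q.2.
  have step (q' : hilbert_hsum H K) :
      (forall i, hdot H (u i) q'.1 = hdot K (v i) q'.2) ->
      forall p', G p' -> hdot H p'.1 q'.1 = hdot K p'.2 q'.2.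
    move=> q'P p' Gp'; apply/subr0_eq.
    (* The sign turns equality of the two inner products into orthogonality
       to one vector of the direct sum. *)
    pose q'' : hilbert_hsum H K := (q'.1, - q'.2).
    suff : ocompl [set q''] p'.
      by move=> /(_ q'' erefl); rewrite hsum_dot_def/= -scaleN1r hdotZr rmorphN rmorph1 mulN1r.
    apply: cspan_sub Gp'; first exact: closed_subspace_ortho.
    move=> _ [i _ <-] _ ->; rewrite hsum_dot_def/= -scaleN1r hdotZr rmorphN rmorph1.
    by rewrite mulN1r q'P subrr.
  move=> Gp Gq; apply: (step q _ p Gp) => i; rewrite hdotC [RHS]hdotC; congr (_ ^*%R).
  by apply: (step (u i, v i)) Gq => j /=.
have Gnorm p : G p -> `|p.1| = `|p.2|.
  move=> Gp; apply/eqP; rewrite -(@eqrXn2 _ 2)//; apply/eqP.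
  by rewrite !hdotE Gdot.
have Gdom x : exists y, G (x, y).
  have : cspan (range u) x by rewrite uT.
  suff DP : closed_subspace (adj (hinl H K) @` G).
    move=> /(cspan_sub DP)[|[x' y] Gxy]; last first.
      by rewrite adj_hinl/= => <-; exists y.
    move=> _ [i _ <-]; exists (u i, v i); last by rewrite adj_hinl.
    by apply: sub_cspan; exists i.
  (* On G both coordinates have the same norm, so |p| is at most 2 |p.1|. *)
  apply: (@closed_subspace_image _ _ _ _ _ 2) => // p Gp.
  rewrite adj_hinl (le_trans (hsum_leD p))// -(Gnorm _ Gp).
  by rewrite mulr2n mulrDl mul1r.
have /choice[t tP] := Gdom.
have Guniq x y y' : G (x, y) -> G (x, y') -> y = y'.
  move=> Gy Gy'; apply/subr0_eq/eqP; rewrite -normr_eq0.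
  have := Gnorm _ (closed_subspaceB GP Gy Gy').
  by rewrite /= subrr normr0 => <-.
have tl : linear t.
  move=> a x y; apply: (Guniq (a *: x + y)) => //.
  by have [_ _ Gl] := GP; exact: (Gl a _ _ (tP x) (tP y)).
have ti x : `|t x| = `|x| by have := Gnorm _ (tP x).
exists (mkbop tl (norm_preserving_bounded ti)) => // i; apply: (Guniq (u i)); first exact: tP.
by apply: sub_cspan; exists i.
Qed.

(** * Doubling an infinite cardinal *)

(** A maximal family of disjoint injective sequences in T leaves only finitely
    many points uncovered. Absorbing these in one of the sequences splits T
    into copies of nat, and the even and the odd halves of these copies give
    the two injections. *)
Lemma infinite_doubling (T : Type) : infinite_set [set: T] ->
  exists i1 i2 : T -> T,
    [/\ injective i1, injective i2 & forall x y, i1 x <> i2 y].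
Proof.
move=> Tinf; pose I := {s : nat -> T | injective s}.
pose B (s : I) := range (sval s).
have [A [_ tA maxA]] := ex_maximal_disjoint_subcollection B setT.
pose rest := ~` \bigcup_(s in A) B s.
have rest_fin : finite_set rest.
  apply: contrapT => /infiniteP/card_leP/unsquash h.
  pose h' n := set_val (h (SigSub (mem_set (Logic.I : [set: nat] n)))).
  have hinj : injective h'.
    by move=> m n /val_inj/(inj (mem_setT _) (mem_setT _))/(congr1 val).
  pose s : I := exist _ h' hinj.
  have sA r : A r -> B r `&` B s = set0.
    move=> Ar; apply/seteqP; split=> // t [rt [n _ ht]].
    have : rest t by rewrite -ht; exact: (set_mem (valP (h _))).
    by apply; exists r.
  have As : ~ A s.
    move=> As; have : (B s `&` B s) (h' 0%N) by split; exists 0%N.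
    by rewrite sA.
  apply: (maxA (A `|` [set s])).
  - split; first exact: subsetUl.
    by move=> /(_ s (or_intror erefl)).
  - by [].
  - move=> r r' [Ar|->] [Ar'|->] rr'; [exact: tA| | |by []].
    + by exfalso; case: rr' => t; rewrite (sA r Ar).
    + by exfalso; case: rr' => t; rewrite setIC (sA r' Ar').
have [s0 As0] : exists s, A s.
  apply: contrapT => /forallNP A0; apply: Tinf.
  by rewrite [setT](_ : _ = rest)//; apply/seteqP; split=> // t _ [s /A0].
pose D := rest `|` B s0.
have Dinf : infinite_set D.
  apply: (sub_infinite_set (@subsetUr _ rest (B s0))).
  apply/infiniteP; have [|_ //] := (card_eqPle _ _).1 (@inj_card_eq _ _ setT (sval s0) _).
  by move=> m n _ _; exact: (svalP s0).
have Dcount : countable D.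
  rewrite /D -bigcup2E; apply: bigcup_countable => // -[|[|n]] _ //=.
    exact: finite_set_countable.
  exact: (card_le_trans (card_image_le _ _)).
have /card_set_bijP[c [_ cI cS]] := eq_card_nat Dcount Dinf.
have /choice[g gP] : forall n, exists t, D t /\ c t = n.
  by move=> n; have [t] := cS n Logic.I; exists t.
(* F replaces the sequence s0 by an enumeration of its range together with
   the uncovered points. *)
pose F (s : I) : nat -> T := if `[< s = s0 >] then g else sval s.
have F0 : F s0 = g by rewrite /F asboolT.
have F1 s : s <> s0 -> F s = sval s by move=> ss0; rewrite /F asboolF.
have Finj s s' n n' : A s -> A s' -> F s n = F s' n' -> s = s' /\ n = n'.
  have aux r m m' : A r -> r <> s0 -> F r m = g m' -> False.
    move=> Ar rs0; rewrite F1// => rg; have [gD _] := gP m'.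
    case: gD; rewrite -rg; first by apply; exists r => //; exists m.
    by move=> Bs; apply: rs0; apply: tA => //; exists (sval r m); split=> //; exists m.
  move=> As As'; have [->|ss0] := pselect (s = s0).
    have [->|s's0] := pselect (s' = s0); last by rewrite F0 => /esym/aux[].
    rewrite F0 => gg; split=> //; have [_ <-] := gP n; have [_ <-] := gP n'.
    by rewrite gg.
  have [->|s's0] := pselect (s' = s0); first by rewrite F0 => /aux[].
  rewrite !F1// => E; have ss : s = s'.
    by apply: tA => //; exists (sval s n); split; [exists n|exists n'].
  by split=> //; move: E; rewrite ss; exact: (svalP s').
have Fcover t : exists sn : I * nat, A sn.1 /\ t = F sn.1 sn.2.
  have [Dt|nDt] := pselect (D t).
    exists (s0, c t); split=> //; rewrite F0; have [Dg gE] := gP (c t).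
    by apply: cI; rewrite ?inE.
  have : ~ rest t by move=> tr; apply: nDt; left.
  move=> /contrapT[s As [n _ st]]; exists (s, n); split=> //=.
  by rewrite F1// => ss0; apply: nDt; right; exists n => //; rewrite -ss0.
have /choice[code codeP] := Fcover.
exists (fun t => F (code t).1 (code t).2.*2), (fun t => F (code t).1 (code t).2.*2.+1).
split=> [t t'|t t'|t t'].
- have [[As tE] [As' t'E]] := (codeP t, codeP t').
  by move=> /Finj[]// ss /double_inj nn; rewrite tE t'E ss nn.
- have [[As tE] [As' t'E]] := (codeP t, codeP t').
  by move=> /Finj[]// ss [/double_inj nn]; rewrite tE t'E ss nn.
- have [[As _] [As' _]] := (codeP t, codeP t').
  by move=> /Finj[]// _ /(congr1 odd); rewrite /= !odd_double.
Qed.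

(** The union of the two orthonormal bases is indexed by two disjoint copies
    of the index set. *)
Lemma hdim_hsum (R : realType) (Kap : Type) (H K : hilbert R) :
  infinite_set [set: Kap] -> hdim_le H Kap -> hdim_le K Kap ->
  hdim_le (hilbert_hsum H K) Kap.
Proof.
move=> /infinite_doubling[i1 [i2 [i1I i2I i12]]].
move=> [J [b [b1 b0 bT]]] [J' [b' [b'1 b'0 b'T]]].
have /choice[c cP] : forall t, exists p : hilbert_hsum H K,
    (forall j, t = i1 j -> p = hinl H K (b j)) /\
    (forall j, t = i2 j -> p = hinr H K (b' j)).
  move=> t; have [[j ->]|n1] := pselect (exists j, t = i1 j).
    by exists (hinl H K (b j)); split=> [j' /i1I ->//|j' /i12].
  have [[j ->]|n2] := pselect (exists j, t = i2 j).
    by exists (hinr H K (b' j)); split=> [j' /esym/i12|j' /i2I ->//].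
  by exists 0; split=> j tj; [case: n1|case: n2]; exists j.
have c1 j : c (i1 j) = hinl H K (b j) by have [h _] := cP (i1 j); exact: h.
have c2 j : c (i2 j) = hinr H K (b' j) by have [_ h] := cP (i2 j); exact: h.
exists (i1 @` J `|` i2 @` J'), c; split.
- move=> _ [[j Jj <-]|[j Jj <-]].
    by rewrite c1 isom_dot ?b1//; exact: hinl_isom.
  by rewrite c2 isom_dot ?b'1//; exact: hinr_isom.
- move=> _ _ [[j Jj <-]|[j Jj <-]] [[j' Jj' <-]|[j' Jj' <-]] jj'.
  + rewrite !c1 isom_dot ?b0//; last exact: hinl_isom.
    by move=> E; apply: jj'; rewrite E.
  + by rewrite c1 c2 hinlr_ortho.
  + by rewrite c1 c2; apply: hdot_eq0C; rewrite hinlr_ortho.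
  + rewrite !c2 isom_dot ?b'0//; last exact: hinr_isom.
    by move=> E; apply: jj'; rewrite E.
- set S := cspan _; have SP : closed_subspace S by exact: cspanP.
  apply/seteqP; split=> // p _; rewrite (hsum_split p).
  apply: (closed_subspaceD SP).
    have : cspan (b @` J) p.1 by rewrite bT.
    apply: (cspan_sub (closed_subspace_preim (hinl H K) SP)) => _ [j Jj <-].
    by apply: sub_cspan; exists (i1 j); [left; exists j|rewrite c1].
  have : cspan (b' @` J') p.2 by rewrite b'T.
  apply: (cspan_sub (closed_subspace_preim (hinr H K) SP)) => _ [j Jj <-].
  by apply: sub_cspan; exists (i2 j); [right; exists j|rewrite c2].
Qed.

(** * Averages of points *)

Local Notation coordinate i x := (@Defs.coord _ _ _ _ i x).

Section Averaging.
Variables (R : realType) (Kap : Type) (lv : levels R Kap).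
Hypothesis Kap_infinite : infinite_set [set: Kap].

Lemma level_double (L : lv) : exists (N : lv) (a1 a2 : bop L N),
  [/\ isom a1, isom a2, forall x y, hdot N (a1 x) (a2 y) = 0 &
      forall y, a1 (adj a1 y) + a2 (adj a2 y) = y].
Proof.
have LL := hdim_hsum Kap_infinite (Hn_dim L) (Hn_dim L).
have [N [u [ui us]]] := Hn_exists lv LL.
exists N, (bcomp u (hinl L L)), (bcomp u (hinr L L)); split.
- by move=> x; rewrite /= ui hinl_isom.
- by move=> x; rewrite /= ui hinr_isom.
- by move=> x y; rewrite /= isom_dot// hinlr_ortho.
- move=> y; have [p <-] := us y; rewrite !adj_comp /= adj_isomE//.
  by rewrite adj_hinl adj_hinr -linearD -hsum_split.
Qed.

Variables (d : nat) (V : 'I_d -> opspace R) (K : forall i, gset lv (opcar (V i))).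
Arguments K : clear implicits.
Hypothesis K_convex : forall i, nc_convex (K i).

Lemma prodK_compress (H L : lv) (al : bop H L) y :
  isom al -> prodK K L y -> prodK K H (compress al y).
Proof.
move=> ali yK i; have [_ _ Kc] := K_convex i.
exact: (Kc _ _ al (coordinate i y)).
Qed.

Lemma prodK_dsum_const (J : Type) (H L : lv) (al : J -> bop H L) z x :
  prodK K H z -> is_dsum (fun j => al j) (fun=> z) x -> prodK K L x.
Proof.
move=> zK [al_sum xal] i; have [KE Kd _] := K_convex i.
apply: (Kd J (fun=> H) L al (fun=> coordinate i z) (coordinate i x)) => //.
  by have [_ [c cP]] := KE _ _ (zK i); exists c.
by split=> // j e; exact: (xal j (existT _ i e)).
Qed.

(** The direct sum of z and U z U, compressed along the diagonal isometry of L
    into two copies of L, is the average of z and U z U. The dilation is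
    trivial in each coordinate in which U commutes with z, so separate
    convexity bounds f at the average. *)
Lemma averaging (f : gfun (prodK K)) (L : lv) (z : prodK K L) (U : bop L L) :
  is_ncfun f -> separately_nc_convex f -> adj U = U -> bcomp U U = bid L ->
  exists m : prodK K L,
    (forall e, set_val m e =
       (2^-1 : R[i]) *: (set_val z e + bcomp U (bcomp (set_val z e) U))) /\
    ((forall i j,
       ~ (forall e, bcomp U (coordinate i (set_val z) e) = bcomp (coordinate i (set_val z) e) U) ->
       ~ (forall e, bcomp U (coordinate j (set_val z) e) = bcomp (coordinate j (set_val z) e) U) ->
       i = j) ->
     ople (f L m) ((2^-1 : R[i]) *: (f L z + bcomp U (bcomp (f L z) U)))).
Proof.
move=> [f_dsum _] f_sep Ua UU.
have UUE x : U (U x) = x by exact: (congr1 (fun S : bop L L => S x) UU).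
have Udot x y : hdot L (U x) y = hdot L x (U y) by rewrite adjP Ua.
have Ui : isom U.
  move=> x; apply/eqP; rewrite -(@eqrXn2 _ 2)//; apply/eqP.
  by rewrite !hdotE Udot UUE.
have [N [a1 [a2' [a1i a2'i a12' aT]]]] := level_double L.
(* The summand U z U along a2' is the summand z along a2' U, so that the
   direct sum has two equal terms. *)
pose a2 : bop L N := bcomp a2' U.
have a2i : isom a2 by move=> x; rewrite /= a2'i Ui.
have a2E x : a2' x = a2 (U x) by rewrite /= UUE.
have a2a y : adj a2 y = U (adj a2' y) by rewrite adj_comp Ua.
have a2'a y : adj a2' y = U (adj a2 y) by rewrite a2a UUE.
have a11 y : adj a1 (a1 y) = y by exact: adj_isomE.
have a22 y : adj a2 (a2 y) = y by exact: adj_isomE.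
have a12 y : adj a1 (a2 y) = 0.
  apply: eq_of_hdot => x; rewrite -adjPr hdot0l; by apply: hdot_eq0C; rewrite a12'.
have a21 y : adj a2 (a1 y) = 0.
  by apply: eq_of_hdot => x; rewrite -adjPr hdot0l a12'.
have {}aT y : a1 (adj a1 y) + a2 (adj a2 y) = y.
  by rewrite a2a -a2E aT.
have a12d x y : hdot N (a1 x) (a2 y) = 0 by exact: a12'.
clearbody a2.
pose w e : bop N N := bcomp a1 (bcomp (set_val z e) (adj a1)) +
                      bcomp a2 (bcomp (set_val z e) (adj a2)).
have wE e y : w e y = a1 (set_val z e (adj a1 y)) + a2 (set_val z e (adj a2 y)).
  by [].
pose al2 (b : bool) := if b then a2 else a1.
have w_dsum : is_dsum al2 (fun=> set_val z) w.
  split; last first.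
    move=> [] e; apply: bop_ext => y; rewrite [LHS]wE /= ?a11 ?a12 ?a21 ?a22.
      by rewrite !linear0 add0r.
    by rewrite !linear0 addr0.
  split.
  - by case.
  - by move=> [] [] // _ _ _ [x _ <-] [y _ <-] /=; rewrite ?a12d//; apply: hdot_eq0C.
  - apply/seteqP; split=> // y _; rewrite -(aT y).
    apply: (closed_subspaceD (@cspanP _ _ _)); apply: sub_cspan.
      by exists false => //; exists (adj a1 y).
    by exists true => //; exists (adj a2 y).
have wK : prodK K N w by apply: prodK_dsum_const w_dsum; exact: (set_mem (valP z)).
pose w' : prodK K N := SigSub (mem_set wK).
pose s : R[i] := sqrtC 2^-1.
have ss : s * s = 2^-1 by rewrite -expr2 sqrtCK.
have sJ : s^*%R = s.
  by apply/CrealP; rewrite ger0_real// sqrtC_ge0 invr_ge0.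
pose al : bop L N := s *: (a1 + a2').
have alE x : al x = s *: (a1 x + a2 (U x)) by rewrite -a2E.
have alaE y : adj al y = s *: (adj a1 y + U (adj a2 y)).
  by rewrite adjZ adjD sJ -a2'a.
have ali : isom al.
  move=> x; apply/eqP; rewrite -(@eqrXn2 _ 2)//; apply/eqP; rewrite !hdotE.
  have -> : al x = s *: (a1 x + a2 (U x)) by exact: alE.
  rewrite hdotZl hdotZr sJ mulrA ss !(hdotDl, hdotDr) !isom_dot// a12d.
  rewrite (hdot_eq0C (a12d _ _)) addr0 add0r.
  by field.
have a1al x : adj a1 (al x) = s *: x.
  by rewrite alE bopZ bopD a11 a12 addr0.
have a2al x : adj a2 (al x) = s *: U x.
  by rewrite alE bopZ bopD a21 a22 add0r.
have alw e x : adj al (w e (al x)) =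
    (2^-1 : R[i]) *: (set_val z e x + U (set_val z e (U x))).
  rewrite wE a1al a2al alaE; rewrite !bopD a11 a12 a21 a22 bop0 addr0 add0r.
  by rewrite !bopZ -scalerDr scalerA ss.
have mK : prodK K L (compress al w) by exact: prodK_compress.
exists (SigSub (mem_set mK)); split.
  by move=> e; apply: bop_ext => x; rewrite [LHS]alw.
move=> triv.
have fw1 x : f N w' (a1 x) = a1 (f L z x).
  have := f_dsum bool (fun=> L) N al2 (fun=> z) w' w_dsum false.
  by move=> /(congr1 (fun S : bop L N => S x)).
have fw2 x : f N w' (a2 x) = a2 (f L z x).
  have := f_dsum bool (fun=> L) N al2 (fun=> z) w' w_dsum true.
  by move=> /(congr1 (fun S : bop L N => S x)).
have -> : (2^-1 : R[i]) *: (f L z + bcomp U (bcomp (f L z) U)) =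
    bcomp (adj al) (bcomp (f N w') al).
  apply: bop_ext => x.
  rewrite [RHS](_ : _ = adj al (f N w' (al x)))// alE bopZ bopD fw1 fw2.
  rewrite alaE (bopZ (adj a1)) (bopZ (adj a2)) (bopZ U) !bopD a11 a12 a21 a22 bop0 addr0 add0r -scalerDr.
  by rewrite scalerA ss.
have nontriv i : ~ trivial_dilation i al (set_val w') ->
    ~ (forall e, bcomp U (coordinate i (set_val z) e) =
                 bcomp (coordinate i (set_val z) e) U).
  move=> ni comm; apply: ni => e; apply: bop_ext => y.
  pose e' : prod_index V := existT _ i e.
  have {}comm x : U (set_val z e' x) = set_val z e' (U x).
    by move/(congr1 (fun S : bop L L => S x)): (comm e).
  rewrite [LHS](_ : _ = al (adj al (w e' y)))//.
  rewrite [RHS](_ : _ = w e' (al (adj al y)))//.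
  have -> : adj al (w e' y) = set_val z e' (adj al y).
    by rewrite !alaE wE !bopD a11 a12 a21 a22 bop0 addr0 add0r comm -bopD -bopZ.
  rewrite [LHS]alE wE a1al a2al !(bopZ (set_val z e')) (bopZ a1) (bopZ a2).
  by rewrite -scalerDr comm.
by apply: f_sep => //= i j /nontriv ni /nontriv nj; exact: triv.
Qed.

End Averaging.

(** * Dominated convergence of series *)

Section ComplexSeries.
Variable R : realType.

(** Real and imaginary parts converge separately. *)
Lemma complex_complete (u : nat -> R[i]) :
  (forall e : R[i], 0 < e -> exists N, forall m n, (N <= m)%N -> (N <= n)%N ->
     `|u m - u n| <= e) ->
  exists l : R[i], converges (u : nat -> R[i]^o) l.
Proof.
move=> uC.
have part (r : R[i] -> R) : (forall z w, r (z - w) = r z - r w) ->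
    (forall z, (`|r z|)%:C <= `|z|) -> exists l : R, forall e : R, 0 < e ->
      exists N, forall n, (N <= n)%N -> `|l - r (u n)| <= e.
  move=> rB rP; apply: seq_complete => e e0.
  have [|N NP] := uC e%:C; first by rewrite ltcR.
  exists N => m n Nm Nn; rewrite -rB -lecR.
  by rewrite (le_trans (rP _))// NP.
have [lr lrP] := part (@complex.Re R) (fun z w => raddfB _ z w) (@normc_ge_Re R).
have ImB (z w : R[i]) : complex.Im (z - w) = complex.Im z - complex.Im w.
  by case: z w => a b [a' b'].
have ImN (z : R[i]) : (`|complex.Im z|)%:C <= `|z|.
  have n0 : 0 <= (`|complex.Im z|)%:C :> R[i] by rewrite -[0]/(0%:C) lecR.
  rewrite -(@ler_pXn2r _ 2) ?nnegrE//.
  by rewrite -add_Re2_Im2 -rmorphXn lecR real_normK ?num_real// lerDr sqr_ge0.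
have [li liP] := part (@complex.Im R) ImB ImN.
exists (lr +i* li) => e e0; have e2 := half_gt0 e0.
have eR : 0 < complex.Re (e / 2) by rewrite -ltcR RRe_real// gtr0_real.
have [N1 N1P] := lrP _ eR; have [N2 N2P] := liP _ eR.
exists (maxn N1 N2) => n; rewrite geq_max => /andP[n1 n2].
move: (N1P _ n1) (N2P _ n2); rewrite -!lecR (RRe_real (gtr0_real e2)).
have normR (r : R) : `|r%:C| = `|r|%:C.
  by rewrite normc_def/= expr0n/= addr0 sqrtr_sqr.
case: (u n) => a b /= hr hi; rewrite (splitr e).
rewrite [X in `|X|](_ : _ = (lr - a)%:C + 'i%C * (li - b)%:C); last first.
  exact: (complexE ((lr - a) +i* (li - b))).
rewrite (le_trans (ler_normD _ _))// normrM !normR.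
have -> : `|'i%C : R[i]| = 1 by rewrite normc_def/= expr0n expr1n add0r sqrtr1.
by rewrite mul1r lerD.
Qed.

(** Beyond a partial sum that is e-close to the supremum of all of them
    nothing larger than e can be added. *)
Lemma small_tail (b : nat -> R[i]) (M : R[i]) : (forall k, 0 <= b k) ->
  (forall m, \sum_(k < m) b k <= M) ->
  forall e : R[i], 0 < e ->
    exists m, forall p, (m <= p)%N -> \sum_(m <= k < p) b k <= e.
Proof.
move=> b0 bM e e0; pose s m := \sum_(k < m) complex.Re (b k).
have sE m : \sum_(k < m) b k = (s m)%:C.
  rewrite /s rmorph_sum/=; apply: eq_bigr => k _.
  by rewrite RRe_real// ger0_real.
have MR : M \is Num.real by rewrite ger0_real// (le_trans _ (bM 0%N))// big_ord0.
have hs : has_sup (range s).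
  split; first by exists (s 0%N); exists 0%N.
  exists (complex.Re M) => _ [m _ <-].
  by rewrite -lecR -sE RRe_real.
have eR : 0 < complex.Re e by rewrite -ltcR RRe_real// gtr0_real.
have [_ [m _ <-] mP] := sup_adherent eR hs.
exists m => p mp.
have -> : \sum_(m <= k < p) b k = (s p - s m)%:C.
  apply: (addrI (\sum_(k < m) b k)); transitivity (\sum_(k < p) b k).
    by rewrite -!(big_mkord xpredT) [RHS](big_cat_nat (leq0n m) mp).
  by rewrite !sE -rmorphD/= addrC subrK.
rewrite -(RRe_real (gtr0_real e0)) lecR lerBlDr -lerBlDl.
rewrite (le_trans _ (ltW mP))// lerB//.
by apply: sup_upper_bound => //; exists p.
Qed.

Lemma converges_lim (u : nat -> R[i]) l : converges (u : nat -> R[i]^o) l ->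
  limn (u : nat -> R[i]^o) = l.
Proof. by move=> /convergesP; apply: cvg_lim; exact: norm_hausdorff. Qed.

Lemma sum_tail_le (a b : nat -> R[i]) (m p : nat) : (forall k, `|a k| <= b k) ->
  (m <= p)%N ->
  `|\sum_(k < p) a k - \sum_(k < m) a k| <= \sum_(m <= k < p) b k.
Proof.
move=> ab mp; rewrite -!(big_mkord xpredT) (big_cat_nat (leq0n m) mp)/=.
rewrite addrAC subrr add0r.
by rewrite (le_trans (ler_norm_sum _ _ _))// ler_sum.
Qed.

Lemma dominated_series_converges (a b : nat -> R[i]) (M : R[i]) :
  (forall k, `|a k| <= b k) -> (forall m, \sum_(k < m) b k <= M) ->
  converges (fun n => \sum_(k < n) a k : R[i]^o)
            (limn (fun n => \sum_(k < n) a k : R[i]^o)).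
Proof.
move=> ab bM; have b0 k : 0 <= b k by rewrite (le_trans _ (ab k)).
suff [l ul] : exists l : R[i],
    converges (fun n => \sum_(k < n) a k : R[i]^o) l.
  by rewrite (converges_lim ul).
apply: complex_complete => e e0.
have [m mP] := small_tail b0 bM (half_gt0 e0).
exists m => p q mp mq; rewrite (splitr e).
have -> : \sum_(k < p) a k - \sum_(k < q) a k =
  (\sum_(k < p) a k - \sum_(k < m) a k) - (\sum_(k < q) a k - \sum_(k < m) a k).
  by rewrite opprB addrA subrK.
by rewrite (le_trans (ler_normB _ _))// lerD// (le_trans (sum_tail_le ab _))// mP.
Qed.

Lemma lim_tail_le (a b : nat -> R[i]) (M e : R[i]) (m : nat) :
  (forall k, `|a k| <= b k) -> (forall m, \sum_(k < m) b k <= M) ->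
  (forall p, (m <= p)%N -> \sum_(m <= k < p) b k <= e) ->
  `|limn (fun n => \sum_(k < n) a k : R[i]^o) - \sum_(k < m) a k| <= e.
Proof.
move=> ab bM mP; apply/ler_addgt0Pr => e' e'0.
have [N NP] := dominated_series_converges ab bM e'0.
set l := limn _ in NP *; pose p := maxn N m.
have -> : l - \sum_(k < m) a k =
  (l - \sum_(k < p) a k) + (\sum_(k < p) a k - \sum_(k < m) a k).
  by rewrite addrA subrK.
rewrite (le_trans (ler_normD _ _))// addrC lerD//; last by rewrite NP// leq_maxl.
by rewrite (le_trans (sum_tail_le ab _))// ?mP// leq_maxr.
Qed.

Lemma finite_sum_converges (a : nat -> nat -> R[i]) (c : nat -> R[i]) m :
  (forall k, converges (fun n => a n k : R[i]^o) (c k)) ->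
  converges (fun n => \sum_(k < m) a n k : R[i]^o) (\sum_(k < m) c k).
Proof.
move=> ac; elim: m => [|m IH] e e0.
  by exists 0%N => n _; rewrite !big_ord0 subrr normr0 ltW.
have e2 := half_gt0 e0; have [N1 N1P] := IH _ e2; have [N2 N2P] := ac m _ e2.
exists (maxn N1 N2) => n; rewrite geq_max => /andP[n1 n2].
rewrite !big_ord_recr/= opprD addrACA (splitr e) (le_trans (ler_normD _ _))//.
by rewrite lerD ?N1P ?N2P.
Qed.

(** Beyond an index where the dominating series has a small tail, both sums
    are close to their truncations, and the truncations are finite sums. *)
Lemma dominated_convergence_series (a : nat -> nat -> R[i]) (c b : nat -> R[i]) (M : R[i]) :
  (forall n k, `|a n k| <= b k) -> (forall k, `|c k| <= b k) ->
  (forall m, \sum_(k < m) b k <= M) ->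
  (forall k, converges (fun n => a n k : R[i]^o) (c k)) ->
  converges (fun n => limn (fun m => \sum_(k < m) a n k : R[i]^o) : R[i]^o)
    (limn (fun m => \sum_(k < m) c k : R[i]^o)).
Proof.
move=> ab cb bM ac e e0; have e4 := half_gt0 (half_gt0 e0).
have b0 k : 0 <= b k by rewrite (le_trans _ (cb k)).
(* A quarter of e for each of the two tails leaves half of it for the finite
   sum. *)
have [m mP] := small_tail b0 bM e4.
have [N NP] := finite_sum_converges m ac (half_gt0 e0).
exists N => n /NP; have := lim_tail_le (ab n) bM mP; have := lim_tail_le cb bM mP.
set lc := limn _; set la := limn _; set sc := \sum_(_ < _) _.
set sa := \sum_(_ < _) _ => h1 h2 h3.
have -> : lc - la = (lc - sc) + (sc - sa) - (la - sa) by ring.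
apply: le_trans (ler_normB _ _) _.
apply: le_trans (lerD (le_trans (ler_normD _ _) (lerD h1 h3)) h2) _.
by rewrite le_eqVlt; apply/orP; left; apply/eqP; field.
Qed.

End ComplexSeries.

(** * Convergence of operators and of nc functions *)

Section InitialTopologies.

Lemma cvg_initial (S : choiceType) (T : topologicalType) (f : S -> T)
    (F : set_system S) {FF : Filter F} (s : S) :
  (f x @[x --> F] --> f s) -> F --> (s : initial_topology f).
Proof.
move=> fF U [_ /= [[W oW <-] Wfs WU]].
by apply: filterS WU _; apply: fF; exact: open_nbhs_nbhs.
Qed.

Lemma cvg_ptws (U : Type) (T : topologicalType) (F : set_system (U -> T))
    {FF : Filter F} (g : U -> T) :
  (forall u, h u @[h --> F] --> g u) -> F --> (g : {ptws U -> T}).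
Proof.
move=> Fg; apply/cvg_sup => u.
exact: (@cvg_initial (U -> T) T (fun h => h u) F FF).
Qed.

Lemma initial_ptws_eval (S : choiceType) (U : Type) (T : topologicalType)
    (phi : S -> {ptws U -> T}) (v : nat -> S) (s : S) :
  v @ \oo --> (s : initial_topology phi) ->
  forall p, phi (v n) p @[n --> \oo] --> phi s p.
Proof.
move=> vs p A Ap; apply: (vs [set s' | A (phi s' p)]).
apply: (@initial_continuous S _ phi s [set h | A (h p)]).
have /cvg_sup/(_ p) h : nbhs (phi s) --> phi s by exact: cvg_id.
by apply: h; exact: (@initial_continuous (U -> T) T (fun h => h p) (phi s) A Ap).
Qed.

End InitialTopologies.

Section OperatorConvergence.
Variables (R : realType) (H : hilbert R).
Implicit Types (T : bop H H).

(** Uniform boundedness supplies the dominating series that turns pointwise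
    convergence into convergence for the ultraweak and ultrastrong topologies. *)
Definition bounded_strong (u : nat -> bop H H) T :=
  (exists2 c : R[i], 0 <= c & forall n, opbound (u n) c) /\
  forall xi, converges (fun n => u n xi) (T xi).

Lemma opbound_lim (u : nat -> bop H H) T c :
  (forall n, opbound (u n) c) -> (forall xi, converges (fun n => u n xi) (T xi)) ->
  opbound T c.
Proof.
move=> uc uT xi; apply/ler_addgt0Pr => e /(uT xi)[N NP].
have -> : T xi = u N xi + (T xi - u N xi) by rewrite addrC subrK.
by rewrite (le_trans (ler_normD _ _))// lerD; [|exact: uc|exact: NP].
Qed.

(** The series is dominated by c (|xi_k|^2 + |eta_k|^2). *)
Lemma normal_functional_converges (u : nat -> bop H H) T p :
  bounded_strong u T ->
  converges (fun n => normal_functional p (u n)) (normal_functional p T).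
Proof.
move=> [[c c0 uc] uT]; have Tc := opbound_lim uc uT.
have [M1 M1P] := sqsumP p.1; have [M2 M2P] := sqsumP p.2.
have cs S k : opbound S c ->
    `|hdot H (S (p.1 k)) (p.2 k)| <= c * (`|p.1 k| ^+ 2 + `|p.2 k| ^+ 2).
  move=> Sc; rewrite (le_trans (cauchy_schwarz _ _))//.
  rewrite (le_trans (ler_wpM2r _ (Sc _)))// -mulrA ler_wpM2l//.
  set x := `|p.1 k|; set y := `|p.2 k|.
  have x0 : 0 <= x by exact: normr_ge0.
  have y0 : 0 <= y by exact: normr_ge0.
  have [xy|yx] := real_leP (ger0_real x0) (ger0_real y0).
    by rewrite (@le_trans _ _ (y ^+ 2))// ?expr2 ?ler_wpM2r// lerDr mulr_ge0.
  by rewrite (@le_trans _ _ (x ^+ 2))// ?expr2 ?ler_wpM2l ?(ltW yx)// lerDl mulr_ge0.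
apply: (@dominated_convergence_series _
  (fun n k => hdot H (u n (p.1 k)) (p.2 k)) (fun k => hdot H (T (p.1 k)) (p.2 k))
  (fun k => c * (`|p.1 k| ^+ 2 + `|p.2 k| ^+ 2)) (c * (M1 + M2))).
- by move=> n k; exact: cs.
- by move=> k; exact: cs.
- by move=> m; rewrite -mulr_sumr big_split ler_wpM2l// lerD.
- move=> k e e0; have k0 : 0 < `|p.2 k| + 1 by rewrite ltr_wpDl.
  have [N NP] := uT (p.1 k) _ (divr_gt0 e0 k0); exists N => n /NP h.
  rewrite -hdotBl (le_trans (cauchy_schwarz _ _))//.
  rewrite (le_trans (ler_wpM2r _ h))// -mulrA ler_piMr ?(ltW e0)//.
  by rewrite mulrC ler_pdivrMr// mul1r lerDl.
Qed.

(** For nonnegative a and b, (a - b)^2 is at most |a - b| (a + b), which is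
    |a^2 - b^2|. *)
Lemma sqrtC_converges (u : nat -> R[i]) (l : R[i]) :
  (forall n, 0 <= u n) -> 0 <= l -> converges (u : nat -> R[i]^o) l ->
  converges (fun n => sqrtC (u n) : R[i]^o) (sqrtC l).
Proof.
move=> u0 l0 ul e e0; have [N NP] := ul _ (exprn_gt0 2 e0).
exists N => n /NP lun; rewrite -(@ler_pXn2r _ 2) ?nnegrE ?(ltW e0)//.
apply: le_trans lun; set a := sqrtC l; set b := sqrtC (u n).
have a0 : 0 <= a by rewrite sqrtC_ge0.
have b0 : 0 <= b by rewrite sqrtC_ge0.
rewrite (_ : l - u n = (a - b) * (a + b)); last first.
  by rewrite mulrDr mulrBl mulrBl (mulrC a b) -!expr2 !sqrtCK addrA subrK.
rewrite normrM expr2 ler_wpM2l//.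
by rewrite (le_trans (ler_normB _ _))// !ger0_norm// addr_ge0.
Qed.

Lemma sqrnorm_converges (u : nat -> H) (l : H) :
  converges u l -> converges (fun n => `|u n| ^+ 2 : R[i]^o) (`|l| ^+ 2).
Proof.
move=> /convergesP ul; apply/convergesP.
have h : (`|u n| : R[i]^o) @[n --> \oo] --> (`|l| : R[i]^o) by exact: cvg_norm ul.
exact: (cvgM h h).
Qed.

Lemma converges_ge0 (u : nat -> R[i]) (l : R[i]) :
  (forall n, 0 <= u n) -> converges (u : nat -> R[i]^o) l -> 0 <= l.
Proof.
move=> u0 /convergesP ul.
have h : (`|u n| : R[i]^o) @[n --> \oo] --> (`|l| : R[i]^o) by exact: cvg_norm ul.
suff -> : l = `|l| by [].
(* The norms converge to |l| as well, so l is its own norm. *)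
have E : (fun n => `|u n|) = u by apply/funext => n; rewrite ger0_norm.
rewrite E in h.
by have := cvg_unique (@norm_hausdorff _ R[i]^o) ul h; apply.
Qed.

Lemma ustrong_seminorm_converges (u : nat -> bop H H) T xi :
  bounded_strong u T -> bounded_strong (fun n => adj (u n)) (adj T) ->
  converges (fun n => ustrong_seminorm xi (u n)) (ustrong_seminorm xi T).
Proof.
move=> [[c c0 uc] uT] [_ uaT]; have Tc := opbound_lim uc uT.
have [M MP] := sqsumP xi.
(* One term for the operator and one for its adjoint. *)
pose b k : R[i] := c ^+ 2 * `|xi k| ^+ 2 + c ^+ 2 * `|xi k| ^+ 2.
have sb S k : opbound S c -> `| `|S (xi k)| ^+ 2 + `|adj S (xi k)| ^+ 2 | <= b k.
  move=> Sc; rewrite ger0_norm ?addr_ge0 ?exprn_ge0// /b -exprMn lerD//.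
    by rewrite ler_pXn2r ?nnegrE ?mulr_ge0.
  by rewrite ler_pXn2r ?nnegrE ?mulr_ge0//; exact: adj_bound.
have bM m : \sum_(k < m) b k <= c ^+ 2 * M + c ^+ 2 * M.
  by rewrite big_split -mulr_sumr lerD// ler_wpM2l// exprn_ge0.
have lim0 S : opbound S c -> 0 <= limn (fun n =>
    \sum_(k < n) (`|S (xi k)| ^+ 2 + `|adj S (xi k)| ^+ 2) : R[i]^o).
  move=> Sc; apply: converges_ge0 (dominated_series_converges (fun k => sb S k Sc) bM).
  by move=> n; rewrite sumr_ge0// => k _; rewrite addr_ge0// exprn_ge0.
apply: sqrtC_converges => [n||]; [exact: lim0|exact: lim0|].
apply: (@dominated_convergence_series _
  (fun n k => `|u n (xi k)| ^+ 2 + `|adj (u n) (xi k)| ^+ 2)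
  (fun k => `|T (xi k)| ^+ 2 + `|adj T (xi k)| ^+ 2) b _ _ _ bM) => [n k|k|k].
- exact: sb.
- exact: sb.
- apply/convergesP; apply: cvgD; apply/convergesP; exact: sqrnorm_converges.
Qed.

Lemma bounded_strongB (u : nat -> bop H H) T S :
  bounded_strong u T -> bounded_strong (fun n => u n - S) (T - S).
Proof.
move=> [[c c0 uc] uT]; have [c' c'0 cS] := bop_bound S; split.
  exists (c + c'); first by rewrite addr_ge0// ltW.
  move=> n xi; rewrite bopBE (le_trans (ler_normB _ _))// mulrDl lerD//.
  exact: uc.
move=> xi e /(uT xi)[N NP]; exists N => n /NP.
by rewrite !bopBE opprB addrA subrK.
Qed.

Lemma weakstar_cvg (u : nat -> bop H H) T : bounded_strong u T ->
  (u : nat -> weakstar H) @ \oo --> (T : weakstar H).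
Proof.
move=> uT; apply: cvg_initial; apply: cvg_ptws => p.
exact/convergesP/normal_functional_converges.
Qed.

Lemma ustrongstar_cvg (u : nat -> bop H H) T :
  bounded_strong u T -> bounded_strong (fun n => adj (u n)) (adj T) ->
  (u : nat -> ustrongstar H) @ \oo --> (T : ustrongstar H).
Proof.
move=> uT uaT; apply: cvg_initial; apply: cvg_ptws => p.
apply/convergesP/ustrong_seminorm_converges; first exact: bounded_strongB.
have E : (fun n => adj (u n - p.2)) = (fun n => adj (u n) - adj p.2).
  by apply/funext => n; rewrite adjB.
by rewrite E adjB; exact: bounded_strongB.
Qed.

(** Square summable sequences with one nonzero term turn the normal
    functionals and the ultrastrong seminorms into expressions in a single
    vector. *)
Definition single (xi : H) (k : nat) : H := if k is 0%N then xi else 0.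

Lemma single_bounded xi : exists M : R[i],
  forall n, \sum_(k < n) `|single xi k| ^+ 2 <= M.
Proof.
exists (`|xi| ^+ 2) => -[|n]; first by rewrite big_ord0 exprn_ge0.
by rewrite big_ord_recl/= big1 ?addr0// => k _; rewrite normr0 expr0n.
Qed.

Definition single_sqsum xi : sqsum H := Sqsum (single_bounded xi).

Lemma lim_single (a : nat -> R[i]) : (forall k, a k.+1 = 0) ->
  limn (fun n => \sum_(k < n) a k : R[i]^o) = a 0%N.
Proof.
move=> a0; apply: converges_lim => e e0; exists 1%N => -[//|n] _.
by rewrite big_ord_recl/= big1 ?addr0 ?subrr ?normr0 ?(ltW e0)// => k _; exact: a0.
Qed.

Lemma normal_functional_single xi T :
  normal_functional (single_sqsum xi, single_sqsum xi) T = hdot H (T xi) xi.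
Proof.
rewrite /normal_functional (@lim_single (fun k => hdot H (T (single xi k)) (single xi k)))//.
by move=> k /=; rewrite hdot0r.
Qed.

Lemma ustrong_seminorm_single xi T :
  ustrong_seminorm (single_sqsum xi) T = sqrtC (`|T xi| ^+ 2 + `|adj T xi| ^+ 2).
Proof.
rewrite /ustrong_seminorm; congr sqrtC.
rewrite (@lim_single (fun k => `|T (single xi k)| ^+ 2 + `|adj T (single xi k)| ^+ 2))//.
by move=> k /=; rewrite !bop0 normr0 expr0n addr0.
Qed.

End OperatorConvergence.

(** A bounded sequence of points that converges strongly together with its
    adjoints converges both weak-* and ultrastrong-*, so either kind of
    continuity of f applies; either kind of convergence of the values controls
    the matrix coefficient at xi. *)
Lemma ncfun_converges (R : realType) (Kap : Type) (lv : levels R Kap) (X : Type)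
    (K : gset lv X) (f : gfun K) (L : lv) (z : nat -> K L) (x : K L) :
  weakstar_continuous f \/ ustrongstar_continuous f ->
  (forall e, bounded_strong (fun n => set_val (z n) e) (set_val x e)) ->
  (forall e, bounded_strong (fun n => adj (set_val (z n) e)) (adj (set_val x e))) ->
  forall xi, converges (fun n => hdot L (f L (z n) xi) xi : R[i]^o)
                       (hdot L (f L x xi) xi).
Proof.
move=> fc zx zax xi; case: fc => /(_ L x) fc.
  pose p := (single_sqsum xi, single_sqsum xi).
  have zxw : z @ \oo --> (x : initial_topology
      (fun x : K L => set_val x : {ptws X -> weakstar L})).
    by apply: cvg_initial; apply: cvg_ptws => e; exact: weakstar_cvg.
  have fzx : (fun n => f L (z n)) @ \oo --> (f L x : weakstar L).
    exact: cvg_comp zxw fc.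
  have /(_ p)/convergesP h := initial_ptws_eval fzx.
  move=> e /h[N NP]; exists N => n /NP.
  by rewrite /= !normal_functional_single.
pose p := (single_sqsum xi, f L x).
have zxw : z @ \oo --> (x : initial_topology
    (fun x : K L => set_val x : {ptws X -> ustrongstar L})).
  by apply: cvg_initial; apply: cvg_ptws => e; exact: ustrongstar_cvg.
have fzx : (fun n => f L (z n)) @ \oo --> (f L x : ustrongstar L).
  exact: cvg_comp zxw fc.
have /(_ p)/convergesP h := initial_ptws_eval fzx.
move=> e e0; have xi0 : 0 < `|xi| + 1 by rewrite ltr_wpDl.
have [N NP] := h _ (divr_gt0 e0 xi0); exists N => n /NP.
rewrite /= !ustrong_seminorm_single subrr.
have -> : adj (0 : bop L L) = 0.
  by apply: adj_eq => y y'; rewrite !bop0E hdot0l hdot0r.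
rewrite bop0E normr0 expr0n addr0 sqrtC0 sub0r normrN.
rewrite ger0_norm ?sqrtC_ge0 ?addr_ge0 ?exprn_ge0// => sb.
have {}sb : `|(f L (z n) - f L x) xi| <= e / (`|xi| + 1).
  apply: le_trans sb; rewrite -(@ler_pXn2r _ 2) ?nnegrE ?sqrtC_ge0 ?addr_ge0 ?exprn_ge0//.
  by rewrite sqrtCK lerDl exprn_ge0.
rewrite distrC -hdotBl [X in `|X|](_ : _ = hdot L ((f L (z n) - f L x) xi) xi).
  rewrite (le_trans (cauchy_schwarz _ _))// (le_trans (ler_wpM2r _ sb))//.
  by rewrite -mulrA ler_piMr ?(ltW e0)// mulrC ler_pdivrMr// mul1r lerDl.
by rewrite bopBE.
Qed.

(** * Reflections and block diagonal parts *)

Section Projections.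
Variables (R : realType) (H : hilbert R).
Implicit Types (M : set H) (T : bop H H).

Lemma proj_id M x : closed_subspace M -> M x -> proj M x = x.
Proof.
move=> MP Mx; have [Mp pP] := projP MP x; apply: (proj_unique MP Mp Mx pP) => y _.
by rewrite subrr hdot0l.
Qed.

Lemma proj_ortho M x :
  closed_subspace M -> (forall y, M y -> hdot H x y = 0) -> proj M x = 0.
Proof.
move=> MP xM; have [Mp pP] := projP MP x; have [_ M0 _] := MP.
by apply: (proj_unique MP Mp M0 pP) => y My; rewrite subr0 xM.
Qed.

Lemma proj_sub M M' x : closed_subspace M -> closed_subspace M' -> M `<=` M' ->
  proj M' (proj M x) = proj M x.
Proof. by move=> MP M'P MM'; apply: proj_id => //; apply: MM'; case: (projP MP x). Qed.

Lemma adj_proj M : closed_subspace M -> adj (proj M) = proj M.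
Proof.
move=> MP; apply: adj_eq => x y.
have [Mx xP] := projP MP x; have [My yP] := projP MP y.
transitivity (hdot H (proj M x) (proj M y)).
  apply/subr0_eq; rewrite -hdotBr; apply: hdot_eq0C; exact: yP.
by apply/esym/subr0_eq; rewrite -hdotBl; exact: xP.
Qed.

Lemma proj_bound M : closed_subspace M -> opbound (proj M) 1.
Proof.
move=> MP x; have [Mx xP] := projP MP x; rewrite mul1r.
rewrite -(@ler_pXn2r _ 2) ?nnegrE// -[in leRHS](subrK (proj M x) x) hnormD.
by rewrite (hdotC (proj M x)) xP// rmorph0 !addr0 lerDr exprn_ge0.
Qed.

Lemma proj_subl M M' x : closed_subspace M -> closed_subspace M' -> M `<=` M' ->
  proj M (proj M' x) = proj M x.
Proof.
move=> MP M'P MM'; apply: eq_of_hdot => z.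
by rewrite !adjP !adj_proj// proj_sub.
Qed.

(** Invariance under T and under its adjoint gives P T P = T P and P T P = P
    T. *)
Lemma invariant_commute M T : closed_subspace M ->
  (forall x, M x -> M (T x)) -> (forall x, M x -> M (adj T x)) ->
  forall x, proj M (T x) = T (proj M x).
Proof.
move=> MP TM TaM x; have inM y : M (proj M y) by case: (projP MP y).
have <- : proj M (T (proj M x)) = T (proj M x).
  by apply: proj_id => //; apply: TM.
apply: eq_of_hdot => z; rewrite adjP adj_proj// adjP.
rewrite [RHS]adjP adj_proj// [RHS]adjP [RHS]adjP adj_proj//.
by rewrite (proj_id MP (TaM _ (inM z))).
Qed.

Definition refl M : bop H H := (2 : R[i]) *: proj M - bid H.

Lemma reflE M x : refl M x = (2 : R[i]) *: proj M x - x.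
Proof. by []. Qed.

Lemma adj_refl M : closed_subspace M -> adj (refl M) = refl M.
Proof.
move=> MP; rewrite /refl adjB adjZ adj_proj// adj_id; congr (_ *: _ - _).
by rewrite rmorph_nat.
Qed.

Lemma reflK M x : closed_subspace M -> refl M (refl M x) = x.
Proof.
move=> MP; rewrite reflE bopB bopZ (proj_id MP); last by case: (projP MP x).
rewrite reflE (_ : (2 : R[i]) *: proj M x - proj M x = proj M x).
  by rewrite opprB addrC subrK.
by rewrite scaler_nat mulr2n addrK.
Qed.

Lemma refl_id M x : closed_subspace M -> M x -> refl M x = x.
Proof.
by move=> MP Mx; rewrite reflE proj_id// scaler_nat mulr2n addrK.
Qed.

Lemma refl_isom M : closed_subspace M -> isom (refl M).
Proof.
move=> MP x; apply/eqP; rewrite -(@eqrXn2 _ 2)//; apply/eqP.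
by rewrite !hdotE adjP adj_refl// reflK.
Qed.

Lemma refl_commute M T x : (forall y, proj M (T y) = T (proj M y)) ->
  refl M (T x) = T (refl M x).
Proof. by move=> MT; rewrite !reflE MT bopB bopZ. Qed.

(** The block diagonal part of T with respect to M and its complement, written
    as an average because averages are what separate convexity handles. *)
Definition pinch M T : bop H H :=
  (2^-1 : R[i]) *: (T + bcomp (refl M) (bcomp T (refl M))).

Lemma pinchE M T x :
  pinch M T x = (2^-1 : R[i]) *: (T x + refl M (T (refl M x))).
Proof. by []. Qed.

Lemma proj_refl M x : closed_subspace M -> proj M (refl M x) = proj M x.
Proof.
move=> MP; rewrite reflE bopB bopZ (proj_id MP); last by case: (projP MP x).
by rewrite scaler_nat mulr2n addrK.
Qed.

Lemma refl_proj M x : closed_subspace M -> refl M (proj M x) = proj M x.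
Proof. by move=> MP; apply: refl_id => //; case: (projP MP x). Qed.

Lemma half_refl M x : closed_subspace M -> (2^-1 : R[i]) *: (x + refl M x) = proj M x.
Proof.
by move=> MP; rewrite reflE addrC subrK scalerA mulVf ?scale1r// pnatr_eq0.
Qed.

Lemma proj_pinch M T x : closed_subspace M ->
  proj M (pinch M T x) = proj M (T (proj M x)).
Proof.
move=> MP; rewrite pinchE bopZ bopD proj_refl// -bopD -bopD -bopZ -bopZ.
by rewrite half_refl.
Qed.

Lemma pinch_proj M T x : closed_subspace M ->
  pinch M T (proj M x) = proj M (T (proj M x)).
Proof. by move=> MP; rewrite pinchE refl_proj// half_refl. Qed.

Lemma adj_pinch M T : closed_subspace M -> adj (pinch M T) = pinch M (adj T).
Proof.
move=> MP; rewrite /pinch adjZ adjD !adj_comp adj_refl//.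
have -> : (2^-1 : R[i])^*%R = 2^-1 by apply/CrealP; rewrite ger0_real// invr_ge0.
congr (_ *: (_ + _)); exact: bop_ext.
Qed.

Lemma pinch_bound M T c : closed_subspace M -> 0 <= c -> opbound T c ->
  opbound (pinch M T) c.
Proof.
move=> MP c0 Tc x; rewrite pinchE normrZ ger0_norm ?invr_ge0//.
rewrite mulrC ler_pdivrMr// (le_trans (ler_normD _ _))//.
rewrite refl_isom// mulr_natr mulr2n lerD// (le_trans (Tc _))//.
by rewrite refl_isom.
Qed.

Lemma converges_comp (u : nat -> bop H H) T (v : nat -> H) x (c : R[i]) :
  0 < c -> (forall n, opbound (u n) c) -> (forall y, converges (fun n => u n y) (T y)) ->
  converges v x -> converges (fun n => u n (v n)) (T x).
Proof.
move=> c0 uc uT vx e e0; have e2 := half_gt0 e0.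
have [N1 N1P] := uT x _ e2; have [N2 N2P] := vx _ (divr_gt0 e2 c0).
exists (maxn N1 N2) => n; rewrite geq_max => /andP[n1 n2].
have -> : T x - u n (v n) = (T x - u n x) + u n (x - v n).
  by rewrite bopB addrA subrK.
rewrite (splitr e) (le_trans (ler_normD _ _))// lerD ?N1P//.
by rewrite (le_trans (uc _ _))// mulrC -ler_pdivlMr// N2P.
Qed.

(** The reflections converge strongly to the reflection in the limit space,
    which commutes with T, so the conjugates of T by the reflections converge
    to T. *)
Lemma pinch_strong (M : nat -> set H) (Moo : set H) T :
  (forall n, closed_subspace (M n)) -> closed_subspace Moo ->
  (forall x, converges (fun n => proj (M n) x) (proj Moo x)) ->
  (forall x, proj Moo (T x) = T (proj Moo x)) ->
  bounded_strong (fun n => pinch (M n) T) T.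
Proof.
move=> MP MooP MM MT; have [c c0 Tc] := bop_bound T; split.
  by exists c; [exact: ltW|move=> n; apply: pinch_bound => //; exact: ltW].
have rr x : converges (fun n => refl (M n) x) (refl Moo x).
  move=> e e0; have [N NP] := MM x _ (half_gt0 e0); exists N => n /NP h.
  rewrite !reflE opprB addrA subrK -scalerBr normrZ ger0_norm//.
  by rewrite mulrC -ler_pdivlMr.
have rb n : opbound (refl (M n)) 1 by move=> x; rewrite refl_isom// mul1r.
move=> x; have Tr : converges (fun n => T (refl (M n) x)) (T (refl Moo x)).
  by apply: (converges_comp (u := fun=> T) c0) => // y e e0; exists 0%N => n _;
    rewrite subrr normr0 ltW.
have := converges_comp ltr01 rb rr Tr.
rewrite -refl_commute// reflK// => h e e0.
have [N NP] := h _ e0; exists N => n /NP; rewrite pinchE => hn.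
rewrite -[X in X - _](half_double (T x)).
rewrite -scalerBr opprD addrACA subrr add0r normrZ ger0_norm ?invr_ge0//.
by rewrite (le_trans _ hn)// ler_piMl// invf_le1// ler1n.
Qed.

End Projections.

(** * Stages of a family of word spaces *)

Section WordDecomposition.
Variables (R : realType) (L : hilbert R) (d : nat).
Variables (N : seq 'I_d -> set L) (Op : 'I_d -> set (bop L L)).

Hypothesis N_ortho : forall v w : seq 'I_d,
  reduced_word v -> reduced_word w -> v != w -> orthogonal_sets (N v) (N w).
Hypothesis Op_adj : forall j T, Op j T -> Op j (adj T).
Hypothesis Op_step : forall j T w xi, Op j T -> reduced_word w -> N w xi ->
  exists v, [/\ reduced_word (j :: v), w = v \/ w = j :: v &
    exists xi1 xi2, [/\ N v xi1, N (j :: v) xi2 & T xi = xi1 + xi2]].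

(** Ordering words by length, then by first letter, puts suffixes first. Words
    of equal rank n + 1 share their first letter, which is n modulo d, so that
    passing to the next stage involves one letter only. *)
Definition word_rank (w : seq 'I_d) : nat :=
  if w is i :: v then (size v * d + i).+1 else 0%N.

Lemma word_rank_cons i v : (word_rank v < word_rank (i :: v))%N.
Proof.
case: v => [//|i' v] /=; rewrite ltnS mulSn.
apply: leq_trans (leq_addr i _).
by rewrite -addnS [leqRHS]addnC leq_add2l.
Qed.

Lemma word_rank_head i v n : word_rank (i :: v) = n.+1 -> (i : nat) = (n %% d)%N.
Proof. by move=> [<-]; rewrite modnMDl modn_small. Qed.

Definition stage (n : nat) : set L :=
  cspan (\bigcup_(w in [set w | reduced_word w /\ (word_rank w <= n)%N]) N w).

Definition stage_union : set L :=
  cspan (\bigcup_(w in [set w : seq 'I_d | reduced_word w]) N w).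

Lemma stageP n : closed_subspace (stage n). Proof. exact: cspanP. Qed.

Lemma stage_unionP : closed_subspace stage_union. Proof. exact: cspanP. Qed.

Lemma sub_stage n w xi :
  reduced_word w -> (word_rank w <= n)%N -> N w xi -> stage n xi.
Proof. by move=> wr wn Nxi; apply: sub_cspan; exists w. Qed.

Lemma stage_mono m n : (m <= n)%N -> stage m `<=` stage n.
Proof.
move=> mn; apply: cspan_sub; first exact: stageP.
by move=> xi [w [wr wm] Nxi]; apply: (sub_stage wr _ Nxi); exact: leq_trans mn.
Qed.

Lemma stage_sub_union n : stage n `<=` stage_union.
Proof.
apply: cspan_sub; first exact: stage_unionP.
by move=> xi [w [wr _] Nxi]; apply: sub_cspan; exists w.
Qed.

Lemma word_ortho_stage n u eta xi : reduced_word u -> (n < word_rank u)%N ->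
  N u eta -> stage n xi -> hdot L eta xi = 0.
Proof.
move=> ur un Nu sxi; apply: hdot_eq0C.
suff : ocompl [set eta] xi by apply.
apply: cspan_sub sxi; first exact: closed_subspace_ortho.
move=> zeta [w [wr wn] Nw] _ ->; apply: hdot_eq0C; apply: N_ortho Nu Nw => //.
by apply: contraTneq wn => <-; rewrite -ltnNge.
Qed.

(** An operator of the j-th algebra connects words that agree or differ by an
    initial letter j. The words of rank n + 1 do not begin with j, and adding
    j to them raises the rank, so nothing connects them with the words of rank
    at most n. *)
Lemma stage_step_dot n j T eta xi : Op j T -> (n %% d)%N != j ->
  stage n.+1 eta -> stage n xi -> hdot L (T eta) xi = hdot L (T (proj (stage n) eta)) xi.
Proof.
move=> OT nj seta sxi; apply/subr0_eq; rewrite -hdotBl -bopB adjP.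
pose Q : bop L L := bid L - proj (stage n).
have QE x : Q x = x - proj (stage n) x by [].
rewrite -QE; have /Op_step Ta := Op_adj OT; apply: hdot_eq0C.
suff : ocompl [set Q eta] (adj T xi) by apply.
apply: (cspan_sub (closed_subspace_preim (adj T)
  (closed_subspace_ortho [set Q eta])) _ sxi) => zeta [w [wr wn] Nw] _ ->.
have [v [jvr wE [xi1 [xi2 [N1 N2 ->]]]]] := Ta _ _ wr Nw.
apply: hdot_eq0C.
suff : ocompl [set xi1 + xi2] (Q eta) by apply.
apply: (cspan_sub (closed_subspace_preim Q
  (closed_subspace_ortho [set xi1 + xi2])) _ seta) => theta [u [ur un] Nu] _ ->.
have [un'|un'] := leqP (word_rank u) n.
  by rewrite QE proj_id ?subrr ?hdot0l//; [exact: stageP|exact: sub_stage Nu].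
rewrite QE proj_ortho ?subr0; [|exact: stageP|]; last first.
  by move=> y; exact: word_ortho_stage Nu.
have vr : reduced_word v by move: jvr => /=; apply: path_sorted.
have vn : (word_rank v <= n)%N.
  by case: wE wn => -> // ; apply: leq_trans; apply: ltnW; exact: word_rank_cons.
rewrite hdotDr (N_ortho ur vr _ Nu N1) ?(N_ortho ur jvr _ Nu N2) ?addr0//.
  apply: contra_neq nj => uE; apply/esym/(@word_rank_head j v).
  rewrite -uE.
  by apply/eqP; rewrite eqn_leq un un'.
by apply: contraTneq vn => <-; rewrite -ltnNge.
Qed.

Lemma stage_step n j T x : Op j T -> (n %% d)%N != j ->
  proj (stage n) (T (proj (stage n.+1) x)) = proj (stage n) (T (proj (stage n) x)).
Proof.
move=> OT nj; have sP := stageP; have sm := stage_mono (leqnSn n).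
apply: eq_of_hdot => z; rewrite adjP adj_proj// [RHS]adjP adj_proj//.
have [sx _] := projP (sP n.+1) x; have [sz _] := projP (sP n) z.
by rewrite (stage_step_dot OT nj sx sz) proj_subl.
Qed.

Lemma stage_step_adj n j T x : Op j T -> (n %% d)%N != j ->
  proj (stage n.+1) (T (proj (stage n) x)) = proj (stage n) (T (proj (stage n) x)).
Proof.
move=> OT nj; have sP := stageP; apply: eq_of_hdot => z.
rewrite adjP adj_proj// adjP adjP adj_proj// (stage_step _ (Op_adj OT) nj).
by rewrite [RHS]adjP adj_proj// [RHS]adjP [RHS]adjP adj_proj.
Qed.

Lemma stage_union_commute j T x : Op j T ->
  proj stage_union (T x) = T (proj stage_union x).
Proof.
have inv S : Op j S -> forall y, stage_union y -> stage_union (S y).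
  move=> OS; apply: (cspan_sub (closed_subspace_preim S stage_unionP)).
  move=> y [w wr Nw]; have [v [jvr _ [y1 [y2 [N1 N2 Sy]]]]] := Op_step OS wr Nw.
  rewrite /= Sy; apply: (closed_subspaceD stage_unionP).
    by apply: sub_cspan; exists v => //; move: jvr => /=; exact: path_sorted.
  by apply: sub_cspan; exists (j :: v).
move=> OT; apply: invariant_commute; first exact: stage_unionP.
  exact: inv.
by apply: inv; exact: Op_adj.
Qed.

(** The vectors at which the projections converge form a closed subspace. It
    contains each word space, where the projections are eventually the
    identity, and the complement of all of them, where the projections vanish. *)
Lemma stage_converges x :
  converges (fun n => proj (stage n) x) (proj stage_union x).
Proof.
pose G : set L := [set x | converges (fun n => proj (stage n) x) (proj stage_union x)].
have sP := stageP; have suP := stage_unionP.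
have GP : closed_subspace G.
  apply/closed_subspaceE; split=> /=.
  - move=> y yP e e0; have e2 := half_gt0 e0.
    have [y' Gy' yy'] := yP _ (half_gt0 e2); have [n0 n0P] := Gy' _ e2.
    exists n0 => n /n0P h.
    pose D : bop L L := proj stage_union - proj (stage n).
    have -> : proj stage_union y - proj (stage n) y = D y' + D (y - y').
      by rewrite -bopD (addrC y') subrK.
    rewrite (splitr e) (le_trans (ler_normD _ _))// lerD//.
    rewrite bopBE (le_trans (ler_normB _ _))//.
    have small M : closed_subspace M -> `|proj M (y - y')| <= e / 2 / 2.
      by move=> MP; rewrite (le_trans (proj_bound MP _))// mul1r.
    by rewrite (splitr (e / 2)) lerD ?small.
  - by move=> e e0; exists 0%N => n _; rewrite !bop0 subrr normr0 ltW.
  - move=> a y z Gy Gz; apply/convergesP; under eq_fun do rewrite linearP.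
    rewrite linearP; apply: cvgD; last exact/convergesP.
    by apply: cvgZr; exact/convergesP.
have uG : stage_union `<=` G.
  apply: cspan_sub => // y [w wr Nw] e e0; exists (word_rank w) => n wn.
  rewrite proj_id//; last by apply: sub_cspan; exists w.
  by rewrite proj_id ?subrr ?normr0 ?ltW//; exact: sub_stage Nw.
have [px pxP] := projP suP x.
rewrite -[x](subrK (proj stage_union x)) -[X in X + _]scale1r.
case: GP => _ _; apply; last exact: uG.
move=> e e0; exists 0%N => n _.
rewrite (proj_ortho suP pxP) proj_ortho ?subrr ?normr0 ?ltW// => y sy.
by apply: pxP; exact: stage_sub_union sy.
Qed.

End WordDecomposition.

(** * Coordinate functions and free product algebras *)

Section CoordinateFunctions.
Variables (R : realType) (Kap : Type) (lv : levels R Kap).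

(** The elements of the predual, seen as affine functions on K. *)
Definition coordfun (X : Type) (K : gset lv X) (e : X) : gfun K :=
  fun H x => set_val x e.

Lemma coordfun_continuous (X : Type) (K : gset lv X) (e : X) :
  weakstar_continuous (@coordfun X K e).
Proof.
move=> H x A Ae.
have h1 := @initial_continuous (K H) {ptws X -> weakstar H} set_val x.
apply: (h1 [set h | A (h e)]).
have /cvg_sup/(_ e) h : nbhs (set_val x : {ptws X -> weakstar H}) -->
    (set_val x : {ptws X -> weakstar H}) by exact: cvg_id.
apply: h; exact: (@initial_continuous (X -> weakstar H) (weakstar H)
  (fun h => h e) (set_val x) A Ae).
Qed.

(** Through these functions hypotheses about the C*-algebra generated by A(K)
    become statements about the operators that make up a point. *)
Lemma coordfun_AK (X : Type) (K : gset lv X) (e : X) : AK K (@coordfun X K e).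
Proof.
split; last exact: coordfun_continuous.
split; first split.
- by move=> J Hs H al xs x [_ xal] j; exact: xal.
- by move=> H L u x y _ xy; rewrite /coordfun xy.
- by move=> H L al x y _ xy; rewrite /coordfun xy.
Qed.

Lemma gfun_one_AK (X : Type) (K : gset lv X) : AK K (@gfun_one _ _ _ _ K).
Proof.
split; last by move=> H; exact: cst_continuous.
have aux H L (al : bop H L) : isom al ->
    bid H = bcomp (adj al) (bcomp (bid L) al).
  by move=> ali; apply: bop_ext => x /=; rewrite adj_isomE.
split; first split.
- by move=> J Hs H al xs x _ j; exact: bop_ext.
- by move=> H L u x y [ui _] _; exact: aux.
- by move=> H L al x y ali _; exact: aux.
Qed.

Lemma CK_cstar (X : Type) (K : gset lv X) : cstar_closed (CK K).
Proof.
split.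
- move=> a f g Cf Cg S [SC AS]; have [Sl _ _ _] := SC.
  by apply: Sl; [exact: Cf|exact: Cg].
- move=> f g Cf Cg S [SC AS]; have [_ Sm _ _] := SC.
  by apply: Sm; [exact: Cf|exact: Cg].
- move=> f Cf S [SC AS]; have [_ _ Ss _] := SC.
  by apply: Ss; exact: Cf.
- move=> f fP S [SC AS]; have [_ _ _ Sc] := SC.
  by apply: Sc => e /fP[g Cg fg]; exists g => //; exact: Cg.
Qed.

Lemma AK_CK (X : Type) (K : gset lv X) : AK K `<=` CK K.
Proof. exact: sub_gen_smallest. Qed.

Variables (d : nat) (V : 'I_d -> opspace R) (K : forall i, gset lv (opcar (V i))).
Arguments K : clear implicits.

Lemma pull_AK i a : AK (K i) a -> AK (prodK K) (pull a).
Proof.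
move=> [[[a_dsum a_unit] a_aff] a_cont]; split; last first.
  move=> H x; have ac := a_cont H (coord_pt x i).
  pose top := initial_topology (fun x : prodK K H =>
    set_val x : {ptws prod_index V -> weakstar H}).
  pose topi := initial_topology (fun x : K i H =>
    set_val x : {ptws opcar (V i) -> weakstar H}).
  have pc : coord_pt y i @[y --> (x : top)] --> (coord_pt x i : topi).
    have xF : Filter (nbhs (x : top)) by exact: (@nbhs_filter top).
    apply: cvg_initial; apply: cvg_ptws => e.
    exact: (@coordfun_continuous _ (prodK K) (existT _ i e) H x).
  by move=> A /ac/pc.
split; first split.
- move=> J Hs H al xs x [al_sum xal] j.
  apply: (a_dsum J Hs H al (fun j => coord_pt (xs j) i) (coord_pt x i)).
  by split=> // j' e; exact: (xal j' (existT _ i e)).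
- move=> H L u x y uu xy; apply: a_unit => //.
  apply/funext => e; exact: (congr1 (fun h => h (existT _ i e)) xy).
- move=> H L al x y ali xy; apply: a_aff => //.
  apply/funext => e; exact: (congr1 (fun h => h (existT _ i e)) xy).
Qed.

(** The functions whose pullback lies in C(K_1 x ... x K_d) form a C*-closed
    set that contains A(K_i). *)
Lemma pull_CK i g : CK (K i) g -> CK (prodK K) (pull g).
Proof.
move=> Cg; have [Cl Cm Cs Cc] := CK_cstar (prodK K).
apply: (Cg [set g | CK (prodK K) (pull g)]); split.
  split=> /=.
  - by move=> a f f' Cf Cf'; exact: Cl.
  - by move=> f f' Cf Cf'; exact: Cm.
  - by move=> f Cf; exact: Cs.
  - move=> f fP; apply: Cc => e /fP[f' Cf' ff']; exists (pull f') => //.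
    by move=> H x; exact: ff'.
by move=> a /pull_AK/AK_CK.
Qed.

Lemma CK_factor_CK i a : CK_factor K i a -> CK (prodK K) a.
Proof. by move=> [g Cg <-]; exact: pull_CK. Qed.

Lemma CK_factor_one i : CK_factor K i (@gfun_one _ _ _ _ _).
Proof. by exists (@gfun_one _ _ _ _ _) => //; apply: AK_CK; exact: gfun_one_AK. Qed.

Lemma CK_factor_mul i a a' :
  CK_factor K i a -> CK_factor K i a' -> CK_factor K i (gfun_mul a a').
Proof.
move=> [g Cg <-] [g' Cg' <-]; exists (gfun_mul g g') => //.
by have [_ Cm _ _] := CK_cstar (K i); exact: Cm.
Qed.

Lemma CK_factor_star i a : CK_factor K i a -> CK_factor K i (gfun_star a).
Proof.
move=> [g Cg <-]; exists (gfun_star g) => //.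
by have [_ _ Cs _] := CK_cstar (K i); exact: Cs.
Qed.

Lemma CK_factor_coordfun i e :
  CK_factor K i (coordfun (K := prodK K) (existT _ i e)).
Proof.
by exists (coordfun (K := K i) e) => //; apply: AK_CK; exact: coordfun_AK.
Qed.

End CoordinateFunctions.

(** * Word spaces of a dilation *)

Section StinespringWords.
Variables (R : realType) (Kap : Type) (lv : levels R Kap) (X : Type).
Variables (K : gset lv X) (I : eqType) (As : I -> set (gfun K)) (L : hilbert R).
Variables (pi : gfun K -> bop L L) (L0 : set L).
Hypothesis As_CK : forall i a, As i a -> CK K a.
Hypothesis As_one : forall i, As i (@gfun_one _ _ _ _ K).
Hypothesis As_mul : forall i a b, As i a -> As i b -> As i (gfun_mul a b).
Hypothesis pi_rep : is_star_rep (CK K) pi.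
Hypothesis L0P : closed_subspace L0.

Lemma word_spaceP w : closed_subspace (word_space As pi L0 w).
Proof.
elim: w => [//|i v IH] /=; apply: closed_subspaceI; first exact: cspanP.
exact: closed_subspace_ortho.
Qed.

(** For v not beginning with i, the closed span of A_i L_v is invariant under
    A_i and is the sum of L_v and L_(i v). The space L_w lies in such a span,
    with v = w, or with w = i v when w begins with i. *)
Lemma word_space_step i a w xi : As i a -> reduced_word w -> word_space As pi L0 w xi ->
  exists v, [/\ reduced_word (i :: v), w = v \/ w = i :: v &
    exists xi1 xi2, [/\ word_space As pi L0 v xi1, word_space As pi L0 (i :: v) xi2 &
      pi a xi = xi1 + xi2]].
Proof.
have [_ pi1 pim _] := pi_rep.
move=> Aa wr Lxi.
have [v [vr wv xiv]] : exists v, [/\ reduced_word (i :: v), w = v \/ w = i :: v &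
    cspan [set eta | exists f xi, [/\ As i f, word_space As pi L0 v xi & eta = pi f xi]] xi].
  (* If w does not begin with i, then v is w, and L_w lies in the span of A_i
     L_w because A_i contains 1. *)
  have out : reduced_word (i :: w) -> exists v, [/\ reduced_word (i :: v), w = v \/ w = i :: v &
      cspan [set eta | exists f xi, [/\ As i f, word_space As pi L0 v xi & eta = pi f xi]] xi].
    move=> iwr; exists w; split=> //; first by left.
    by apply: sub_cspan; exists (@gfun_one _ _ _ _ K), xi; split=> //; rewrite pi1.
  case: w wr Lxi out => [|j v] wr Lxi out; first exact: out.
  have [ij|ij] := eqVneq i j; last by apply: out; rewrite /reduced_word/= ij.
  by subst j; exists v; split=> //; [right|case: Lxi => Lxi _].
exists v; split=> //; move: xiv; set C := cspan _ => xiv.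
have CP : closed_subspace C by exact: cspanP.
have Ca : C (pi a xi).
  apply: (cspan_sub (closed_subspace_preim (pi a) CP) _ xiv) => _ [f [zeta [Af Lz ->]]] /=.
  apply: sub_cspan; exists (gfun_mul a f), zeta; split=> //; first exact: As_mul.
  by rewrite (pim _ _ (As_CK Aa) (As_CK Af)).
have [Lp pP] := projP (word_spaceP v) (pi a xi).
exists (proj (word_space As pi L0 v) (pi a xi)),
  (pi a xi - proj (word_space As pi L0 v) (pi a xi)); split=> //; last first.
  by rewrite addrC subrK.
split; last exact: pP.
apply: (closed_subspaceB CP Ca); apply: sub_cspan.
exists (@gfun_one _ _ _ _ K), (proj (word_space As pi L0 v) (pi a xi)).
by split=> //; rewrite pi1.
Qed.

End StinespringWords.

Section Comparison.
Variables (R : realType) (Kap : Type) (lv : levels R Kap) (X : Type).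
Variables (K : gset lv X) (H : lv) (mu : gfun K -> bop H H).
Arguments K : clear implicits.

(** The inner products of the vectors pi f (W xi) are determined by mu, hence
    agree with those of the vectors f(x) (al xi); this is the uniqueness of
    the minimal dilation, read at a point x that represents mu. *)
Lemma stinespring_embedding (L0 : hilbert R) (pi : gfun K -> bop L0 L0) (W : bop H L0)
    (L : lv) (x : K L) (al : bop H L) :
  is_min_stinespring (CK K) mu pi W -> isom al ->
  (forall g, CK K g -> mu g = bcomp (adj al) (bcomp (g L x) al)) ->
  exists T : bop L0 L, [/\ isom T,
    forall g eta, CK K g -> T (pi g eta) = g L x (T eta) &
    forall xi, T (W xi) = al xi].
Proof.
move=> [[_ pi1 pim pis] Wi muW piT] ali mual.
have [Cl Cm Cs Cc] := CK_cstar K.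
pose I := {p : gfun K * H | CK K p.1}.
pose u (p : I) := pi (sval p).1 (W (sval p).2).
pose v (p : I) := (sval p).1 L x (al (sval p).2).
have uv p q : hdot L0 (u p) (u q) = hdot L (v p) (v q).
  case: p q => [[f xi] /= Cf] [[g eta] /= Cg]; rewrite /u /v /=.
  have Cgf : CK K (gfun_mul (gfun_star g) f) by apply: Cm => //; exact: Cs.
  rewrite adjPr -pis// [RHS]adjPr.
  transitivity (hdot H (mu (gfun_mul (gfun_star g) f) xi) eta).
    rewrite muW//= pim//; last exact: Cs.
    by rewrite -adjPr.
  by rewrite mual//= -adjPr.
have uT : cspan (range u) = setT.
  rewrite -piT; congr cspan; apply/seteqP; split=> eta.
    by move=> [[[f xi] /= Cf] _ <-]; exists f, xi.
  by move=> [f [xi [Cf ->]]]; exists (exist _ (f, xi) Cf).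
have [T Ti TP] := gram_isometry uv uT.
have TE f xi : CK K f -> T (pi f (W xi)) = f L x (al xi).
  by move=> Cf; exact: (TP (exist _ (f, xi) Cf)).
exists T; split=> // [g eta Cg|xi]; last first.
  by have := TE _ xi (AK_CK (gfun_one_AK K)); rewrite pi1.
pose D : bop L0 L := bcomp T (pi g) - bcomp (g L x) T.
apply/subr0_eq; have : cspan (range u) eta by rewrite uT.
apply: (cspan_sub (closed_subspace_preim D (closed_subspace0 L))).
move=> _ [[[f xi] /= Cf] _ <-]; apply/eqP; rewrite subr_eq0; apply/eqP.
have E : pi g (pi f (W xi)) = pi (gfun_mul g f) (W xi) by rewrite pim.
by rewrite /u/= E !TE//; exact: Cm.
Qed.

End Comparison.

(** * The Jensen inequality *)

Lemma closed_subspace_range (R : realType) (H L : hilbert R) (al : bop H L) :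
  isom al -> closed_subspace (range al).
Proof.
move=> ali; apply: (@closed_subspace_image _ _ _ al setT 1) => //.
by move=> x _; rewrite mul1r ali.
Qed.

Lemma proj_range (R : realType) (H L : hilbert R) (al : bop H L) x :
  isom al -> proj (range al) x = al (adj al x).
Proof.
move=> ali; have rP := closed_subspace_range ali.
have [pr pP] := projP rP x; apply: (proj_unique rP pr _ pP); first by exists (adj al x).
by move=> _ [y _ <-]; rewrite adjPr bopB adj_isomE// subrr hdot0l.
Qed.

Lemma stage0 (R : realType) (L : hilbert R) (d : nat) (N : seq 'I_d -> set L) :
  closed_subspace (N [::]) -> stage N 0 = N [::].
Proof.
move=> NP; apply/seteqP; split.
  by apply: cspan_sub => // xi [[|i w]] [_ //] _.
by move=> xi Nxi; exact: (@sub_stage _ _ _ N _ [::]).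
Qed.

Section Jensen.
Variables (R : realType) (Kap : Type) (lv : levels R Kap).
Hypothesis Kap_infinite : infinite_set [set: Kap].
Variables (d : nat) (V : 'I_d -> opspace R) (K : forall i, gset lv (opcar (V i))).
Arguments K : clear implicits.
Hypothesis K_convex : forall i, nc_convex (K i).
Variable f : gfun (prodK K).
Arguments f : clear implicits.
Hypothesis f_nc : is_ncfun f.
Hypothesis f_sep : separately_nc_convex f.
Variables (k L : lv) (b : prodK K k) (x : prodK K L) (al : bop k L).
Hypothesis al_isom : isom al.
Hypothesis b_compress : forall e, set_val b e = bcomp (adj al) (bcomp (set_val x e) al).
Variable N : seq 'I_d -> set L.
Hypothesis N0 : N [::] = range al.
Hypothesis stage_left : forall n (i : 'I_d) (e : opcar (V i)) y, (n %% d)%N != i ->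
  proj (stage N n) (set_val x (existT _ i e) (proj (stage N n.+1) y)) =
  proj (stage N n) (set_val x (existT _ i e) (proj (stage N n) y)).
Hypothesis stage_right : forall n (i : 'I_d) (e : opcar (V i)) y, (n %% d)%N != i ->
  proj (stage N n.+1) (set_val x (existT _ i e) (proj (stage N n) y)) =
  proj (stage N n) (set_val x (existT _ i e) (proj (stage N n) y)).

(** At stage 0 the point b is a compression of z by a trivial dilation.
    Between the stages n and n + 1, averaging z with its conjugate by the
    reflection in stage n dilates a single coordinate: z agrees with x on
    stage n + 1, where in the other coordinates the operators of x do not
    connect stage n with its complement. The average agrees with x on stage n,
    and the reflection fixes the range of al, so the values of f at the
    average and at z compare there. *)
Lemma jensen_stage n (z : prodK K L) :
  (forall e y, proj (stage N n) (set_val z e y) = set_val z e (proj (stage N n) y)) ->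
  (forall e y, proj (stage N n) (set_val z e (proj (stage N n) y)) =
               proj (stage N n) (set_val x e (proj (stage N n) y))) ->
  forall xi, hdot k (f k b xi) xi <= hdot L (f L z (al xi)) (al xi).
Proof.
elim: n z => [|n IH] z zcomm zx xi; have sP := @stageP _ _ _ N.
  have s0 : stage N 0 = range al by rewrite stage0 N0//; exact: closed_subspace_range.
  have P0 y : proj (stage N 0) y = al (adj al y) by rewrite s0 proj_range.
  have bz : set_val b = compress al (set_val z).
    apply/funext => e; rewrite b_compress; apply: bop_ext => y /=.
    have := zx e (al y); rewrite !P0 adj_isomE// => /(congr1 (adj al)).
    by rewrite !adj_isomE.
  have triv i : trivial_dilation i al (set_val z).
    by move=> e; apply: bop_ext => y /=; rewrite -!P0; exact: zcomm.
  have := f_sep al_isom bz (fun i j ni => False_ind _ (ni (triv i))) xi.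
  by rewrite bopBE hdotBl subr_ge0 /= -adjPr.
pose P := proj (stage N n); pose P' := proj (stage N n.+1).
have PP y : P (P y) = P y by apply: proj_id => //; case: (projP (sP n) y).
have P'P y : P' (P y) = P y by apply: proj_sub => //; exact: stage_mono.
have PP' y : P (P' y) = P y by apply: proj_subl => //; exact: stage_mono.
pose U := refl (stage N n).
have UU : bcomp U U = bid L by apply: bop_ext => y; exact: reflK.
have [m [mE mle]] := averaging Kap_infinite K_convex z f_nc f_sep (adj_refl (sP n)) UU.
have mP e : set_val m e = pinch (stage N n) (set_val z e) by exact: mE.
have PzP e y : P (set_val z e (P y)) = P (set_val x e (P y)).
  rewrite -[LHS]PP' -{1}[P y]P'P /P /P'.
  by rewrite zx -/P -/P' PP' P'P.
have fb_le := IH m _ _ xi.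
apply: le_trans (fb_le _ _) _.
- by move=> e y; rewrite mP proj_pinch// pinch_proj.
- by move=> e y; rewrite mP pinch_proj// PP; exact: PzP.
have ali : stage N n (al xi).
  by apply: (@sub_stage _ _ _ N _ [::]) => //; rewrite N0; exists xi.
have comm (i : 'I_d) : (n %% d)%N != i -> forall e,
    bcomp U (@Defs.coord _ _ _ _ i (set_val z) e) = bcomp (@Defs.coord _ _ _ _ i (set_val z) e) U.
  move=> ni e; apply: bop_ext => y; apply: refl_commute => {}y.
  pose e' : prod_index V := existT _ i e.
  have P'id w : P' (P' w) = P' w by apply: proj_id => //; case: (projP (sP n.+1) w).
  have Pz w : P (set_val z e' w) = P (set_val x e' (P' w)).
    by rewrite -[LHS]PP' -[P' _]P'id /P' zcomm zx -/P' PP'.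
  have zP w : set_val z e' (P w) = P' (set_val x e' (P w)).
    by rewrite -{1}[P w]P'P -{1}[P' (P w)]P'id /P' -zcomm zx -/P' P'P.
  rewrite [LHS]Pz [RHS]zP.
  by rewrite /P /P' (stage_left e y ni) -(stage_right e y ni).
have single i j : ~ (forall e, bcomp U (@Defs.coord _ _ _ _ i (set_val z) e) =
      bcomp (@Defs.coord _ _ _ _ i (set_val z) e) U) ->
    ~ (forall e, bcomp U (@Defs.coord _ _ _ _ j (set_val z) e) =
      bcomp (@Defs.coord _ _ _ _ j (set_val z) e) U) -> i = j.
  move=> ni nj; apply/val_inj => /=.
  have /eqP <- : (n %% d)%N == i by apply: contrapT => /negP/comm.
  by apply/eqP; apply: contrapT => /negP/comm.
have := mle single (al xi); rewrite bopBE hdotBl subr_ge0 => /le_trans; apply.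
have Ual : U (al xi) = al xi by exact: refl_id.
rewrite bopZE bopDE [X in hdot L (_ *: (_ + X)) _](_ : _ = U (f L z (al xi))); last first.
  exact: (congr1 (fun v => U (f L z v)) Ual).
rewrite hdotZl hdotDl [X in _ + X]adjP adj_refl// Ual.
have half (t : R[i]) : 2^-1 * (t + t) = t by field.
by rewrite half.
Qed.

End Jensen.

Theorem theorem1p1 (R : realType) (Kap : Type)
  (Kap_infinite : infinite_set [set: Kap])
  (lv : levels R Kap)
  (d : nat) (d_gt0 : (0 < d)%N)
  (V : 'I_d -> opspace R)
  (V_density : forall i, opspace_density_le (V i) Kap)
  (K : forall i, gset lv (opcar (V i)))
  (K_compact : forall i, compact_nc_convex (K i))
  (CKi_density : forall i, density_le (CK (K i)))
  (CK_density : density_le (CK (prodK K)))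
  (f : gfun (prodK K))
  (f_sa : forall H x, selfadj (f H x))
  (f_nc : is_ncfun f)
  (f_cont : weakstar_continuous f \/ ustrongstar_continuous f)
  (f_sep : separately_nc_convex f)
  (k : lv)
  (mui : forall i, gfun (K i) -> bop k k)
  (mui_ucp : forall i, is_ucp (CK (K i)) (mui i))
  (mu : gfun (prodK K) -> bop k k)
  (mu_free : is_free_product_ucp (CK (prodK K)) (CK_factor K) mu)
  (mu_mui : forall i g, CK (K i) g -> mu (pull g) = mui i g)
  (b : prodK K k) (b_bar : is_bar mu b)
  (muf : bop k k) (muf_value : is_value mu f muf) :
  ople (f k b) muf.
Proof.
have K_convex i : nc_convex (K i) by have [] := K_compact i.
have [L [x [al [ali mual ->]]]] := muf_value.
have [mu_ucp [L0 [pi [W [min orth]]]]] := mu_free.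
have [T [Ti Tpi TW]] := stinespring_embedding min ali mual.
have [pi_rep Wi _ _] := min.
have L0P := closed_subspace_range Wi.
pose N (w : seq 'I_d) : set L := T @` word_space (CK_factor K) pi (range W) w.
(* The image of the j-th factor in the representation by evaluation at x. *)
pose Op (j : 'I_d) : set (bop L L) := [set S | exists2 a, CK_factor K j a & S = a L x].
have N0 : N [::] = range al.
  rewrite /N /=; apply/seteqP; split=> eta.
    by move=> [_ [xi _ <-] <-]; exists xi => //; rewrite TW.
  by move=> [xi _ <-]; exists (W xi); [exists xi|rewrite TW].
have N_ortho v w : reduced_word v -> reduced_word w -> v != w -> orthogonal_sets (N v) (N w).
  move=> vr wr vw _ _ [xi Nxi <-] [eta Neta <-].
  by rewrite isom_dot//; exact: orth vw _ _ Nxi Neta.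
have Op_adj j S : Op j S -> Op j (adj S).
  by move=> [a Aa ->]; exists (gfun_star a) => //; exact: CK_factor_star.
have Op_step j S w xi : Op j S -> reduced_word w -> N w xi ->
  exists v, [/\ reduced_word (j :: v), w = v \/ w = j :: v &
    exists xi1 xi2, [/\ N v xi1, N (j :: v) xi2 & S xi = xi1 + xi2]].
  move=> [a Aa ->] wr [eta Neta <-].
  have [v [jvr wv [eta1 [eta2 [N1 N2 E]]]]] := word_space_step (@CK_factor_CK _ _ _ _ _ K)
    (@CK_factor_one _ _ _ _ _ K) (@CK_factor_mul _ _ _ _ _ K) pi_rep L0P Aa wr Neta.
  exists v; split=> //; exists (T eta1), (T eta2); split; [by exists eta1|by exists eta2|].
  by rewrite -Tpi ?E ?bopD//; exact: CK_factor_CK Aa.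
have Opx (e : prod_index V) : Op (projT1 e) (set_val x e).
  by case: e => i e; exists (coordfun (K := prodK K) (existT _ i e)) => //;
    exact: CK_factor_coordfun.
have b_compress e : set_val b e = bcomp (adj al) (bcomp (set_val x e) al).
  rewrite -[LHS](_ : mu (coordfun (K := prodK K) e) = _); last first.
    by rewrite -(b_bar _ (coordfun_AK (prodK K) e)).
  by rewrite mual//; apply: AK_CK; exact: coordfun_AK.
have sP := @stageP _ _ _ N; have suP := @stage_unionP _ _ _ N.
have UU n : bcomp (refl (stage N n)) (refl (stage N n)) = bid L.
  by apply: bop_ext => y; exact: reflK.
(* The points z n are the block diagonal parts of x along the stages. *)
have /choice[z zE] : forall n, exists m : prodK K L,
    forall e, set_val m e = pinch (stage N n) (set_val x e).
  move=> n; have [m [mE _]] := averaging Kap_infinite K_convex x f_nc f_sep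
    (adj_refl (sP n)) (UU n).
  by exists m.
have left_inv m (i : 'I_d) (e : opcar (V i)) y (mi : (m %% d)%N != i) :=
  stage_step N_ortho Op_adj Op_step y (Opx (existT _ i e)) mi.
have right_inv m (i : 'I_d) (e : opcar (V i)) y (mi : (m %% d)%N != i) :=
  stage_step_adj N_ortho Op_adj Op_step y (Opx (existT _ i e)) mi.
have le_z n xi : hdot k (f k b xi) xi <= hdot L (f L (z n) (al xi)) (al xi).
  apply: (jensen_stage Kap_infinite K_convex f_nc f_sep ali b_compress N0
    left_inv right_inv (n := n)).
  - by move=> e y; rewrite zE proj_pinch// pinch_proj.
  - move=> e y; rewrite zE pinch_proj//; apply: proj_id => //.
    by case: (projP (sP n) (set_val x e (proj (stage N n) y))).
have conv := stage_converges N.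
have zx e : bounded_strong (fun n => set_val (z n) e) (set_val x e).
  under eq_fun do rewrite zE.
  apply: (pinch_strong sP suP conv) => y.
  exact: (stage_union_commute Op_adj Op_step _ (Opx e)).
have zax e : bounded_strong (fun n => adj (set_val (z n) e)) (adj (set_val x e)).
  under eq_fun do rewrite zE adj_pinch//.
  apply: (pinch_strong sP suP conv) => y.
  exact: (stage_union_commute Op_adj Op_step _ (Op_adj _ _ (Opx e))).
(* Only for real numbers does |s - t| bound s - t in the order of the complex
   numbers. *)
have real H (y : prodK K H) xi : hdot H (f H y xi) xi \is Num.real.
  by apply/CrealP; rewrite -hdotC adjPr f_sa.
move=> xi; rewrite bopBE hdotBl subr_ge0 /= -adjPr.
apply/ler_addgt0Pr => e e0.
have [n /(_ n (leqnn n)) nP] := ncfun_converges f_cont zx zax (al xi) e0.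
apply: le_trans (le_z n xi) _; rewrite -lerBlDl.
apply: le_trans (real_ler_norm _) _; first by rewrite rpredB.
by rewrite distrC.
Qed.
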